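(* Let $c,h,h_W,\alpha,\beta\in\mathbb{C}$. Suppose that a singular vector $u'\in\mathcal{W}\subseteq V(c,h,h_W)$ generates the maximal submodule $J(c,h,h_W)$ of $V(c,h,h_W)$. Then the $\mathcal{L}$-module $V'_{\alpha,\beta,0}\otimes L(c,h,h_W)$ is reducible.
   Context: $\mathbb{N}=\{1,2,\dots\}$. $\mathcal{L}=W(2,2)$ is the complex Lie algebra with basis $\{W_n,L_n,C:n\in\mathbb{Z}\}$ and brackets $[L_n,L_m]=(n-m)L_{n+m}+\delta_{n,-m}\frac{n^3-n}{12}C$, $[L_n,W_m]=(n-m)W_{n+m}+\delta_{n,-m}\frac{n^3-n}{12}C$, $[W_n,W_m]=0$, $[\mathcal{L},C]=0$. Put $\mathcal{L}_{+}=\bigoplus_{n>0}(\mathbb{C}L_{n}+\mathbb{C}W_{n})$. The Verma module $V(c,h,h_W)$ is the quotient of $U(\mathcal{L})$ by the left ideal generated by $L_n,W_n$ ($n\in\mathbb{N}$), $C-c$, $L_0-h$, $W_0-h_W$; $v$ is the image of $1$. $J(c,h,h_W)$ is its unique maximal (proper) submodule and $L(c,h,h_W)=V(c,h,h_W)/J(c,h,h_W)$. $\mathcal{W}$ is the span of the vectors $W_{-m_s}\cdots W_{-m_1}v$ with $m_s\ge\cdots\ge m_1\ge1$, $s\ge0$. A singular vector is a nonzero $L_0$-eigenvector annihilated by $\mathcal{L}_+$. Intermediate series: $V_{\alpha,\beta,0}$ has basis $\{v_m:m\in\mathbb{Z}\}$ and action $L_nv_m=-(m+\alpha+\beta+n\beta)v_{m+n}$,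 $Cv_m=W_nv_m=0$. $V_{\alpha,\beta,0}\cong V_{\alpha+k,\beta,0}$ for $k\in\mathbb{Z}$ by shifting indices. Put $V'_{0,0,0}=V_{0,0,0}/\mathbb{C}v_0$, $V'_{0,1,0}=\bigoplus_{m\ne-1}\mathbb{C}v_m\subseteq V_{0,1,0}$ (for integral $\alpha$ and $\beta\in\{0,1\}$, use the shift: quotient by $\mathbb{C}v_{-\alpha}$ if $\beta=0$, omit $v_{-\alpha-1}$ if $\beta=1$), and $V'_{\alpha,\beta,0}=V_{\alpha,\beta,0}$ otherwise. The tensor product carries the usual action $a(x\otimes y)=ax\otimes y+x\otimes ay$ for $a\in\mathcal{L}$. *)

(* Defs.v *)
From HB Require Import structures.
From mathcomp Require Import all_boot all_order all_algebra.
From mathcomp Require Import finmap.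
From mathcomp Require Import ring.
From mathcomp Require Import boolp.
From mathcomp.multinomials Require Import monalg.

Set Implicit Arguments.
Unset Strict Implicit.
Unset Printing Implicit Defensive.

Import Order.TTheory GRing.Theory Num.Theory.
Local Open Scope ring_scope.
Local Open Scope quotient_scope.

(* {malg K[I]} serves as the K-vector space with basis I, the basis vector    *)
(* indexed by i being << i >>; lext and bext are the linear and bilinear      *)
(* maps with prescribed values on basis vectors.                              *)
HB.lock Definition lext (K : fieldType) (I : choiceType) (V : lmodType K)
    (f : I -> V) (x : {malg K[I]}) : V :=
  \sum_(i <- msupp x) x@_i *: f i.
Canonical lext_unlockable := Unlockable lext.unlock.

Section LinearExtension.
Context {K : fieldType} {I : choiceType} {V : lmodType K}.
Local Notation lext := (@lext K I V).

Lemma lextEw f x (d : {fset I}) :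
  (msupp x `<=` d)%fset -> lext f x = \sum_(i <- d) x@_i *: f i.
Proof.
move=> le; rewrite unlock; apply: (big_fset_incl _ le) => i _ /mcoeff_outdom ->.
by rewrite scale0r.
Qed.

Lemma lext_linear f : linear (lext f).
Proof.
move=> a x y; pose d := (msupp x `|` msupp y `|` msupp (a *: x + y)%R)%fset.
have dx : (msupp x `<=` d)%fset by apply: fsubset_trans (fsubsetUl _ _); apply: fsubsetUl.
have dy : (msupp y `<=` d)%fset by apply: fsubset_trans (fsubsetUl _ _); apply: fsubsetUr.
rewrite (lextEw f dx) (lextEw f dy) (lextEw f (fsubsetUr _ _ : (_ `<=` d)%fset)).
rewrite scaler_sumr -big_split /=; apply: eq_bigr => i _.
by rewrite mcoeffD mcoeffZ scalerDl scalerA.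
Qed.

HB.instance Definition _ f :=
  GRing.isLinear.Build K {malg K[I]} V *:%R (lext f) (lext_linear f).

Lemma lextU f i : lext f << i >> = f i.
Proof.
rewrite (@lextEw _ _ [fset i]%fset) ?msuppU_le // big_seq_fset1.
by rewrite mcoeffUU scale1r.
Qed.

Lemma lext_comb (f g : I -> V) a x :
  lext (fun i => a *: f i + g i) x = a *: lext f x + lext g x.
Proof.
rewrite unlock scaler_sumr -big_split /=; apply: eq_bigr => i _.
by rewrite scalerDr !scalerA mulrC.
Qed.

End LinearExtension.

Lemma malgU_scale (K : fieldType) (I : choiceType) (a b : K) (i : I) :
  a *: << b *g i >> = << a * b *g i >>.
Proof. by apply/malgP => j; rewrite mcoeffZ !mcoeffU mulrnAr. Qed.

Lemma malg_lind (K : fieldType) (I : choiceType) (P : {malg K[I]} -> Prop) :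
  P 0 -> (forall a x y, P x -> P y -> P (a *: x + y)) ->
  (forall i, P << i >>) -> forall x, P x.
Proof.
move=> P0 PD PU x; rewrite [x]monalgE.
apply: big_ind => // [u v Pu Pv|i _]; first by rewrite -[u]scale1r; apply: PD.
have -> : << x@_i *g i >> = x@_i *: << i >> + 0 :> {malg K[I]}.
  by rewrite malgU_scale mulr1 addr0.
exact: PD.
Qed.

Section BilinearExtension.
Context {K : fieldType} {I J : choiceType} {V : lmodType K}.

Definition bext (f : I -> J -> V) (x : {malg K[I]}) (y : {malg K[J]}) : V :=
  lext (fun i => lext (f i) y) x.

Lemma bext_linearl f y : linear (bext f ^~ y).
Proof. exact: lext_linear. Qed.

Lemma bext_linearr f x : linear (bext f x).
Proof.
move=> a y z; rewrite /bext -lext_comb; congr (lext _ _).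
by apply/funext => i; apply: lext_linear.
Qed.

Lemma bextUU f i j : bext f << i >> << j >> = f i j.
Proof. by rewrite /bext !lextU. Qed.

End BilinearExtension.

Section Subspaces.
Context {K : fieldType}.

Record subspace (V : lmodType K) := Subspace {
  subspace_pred :> {pred V};
  subspaceP : submod_closed subspace_pred
}.

HB.instance Definition _ (V : lmodType K) (S : subspace V) :=
  GRing.isSubmodClosed.Build K V (subspace_pred S)
    (GRing.submod_closed_semi (subspaceP S)).

Lemma cap_submod (V : lmodType K) T (f : T -> subspace V) (P : T -> Prop) :
  submod_closed [pred x | `[< forall S, P S -> x \in f S >]].
Proof.
split=> [|a u v]; rewrite !inE.
  by apply/asboolP => S _; apply: rpred0.
move=> /asboolP hu /asboolP hv; apply/asboolP => S PS.
by apply: rpredD; [apply: rpredZ; apply: hu | apply: hv].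
Qed.

Definition span (V : lmodType K) (G : V -> Prop) : subspace V :=
  Subspace (cap_submod id (fun S => forall y, G y -> y \in S)).

Lemma span_sub (V : lmodType K) (G : V -> Prop) (S : subspace V) :
  (forall y, G y -> y \in S) -> {subset span G <= S}.
Proof. by move=> GS x /asboolP; apply. Qed.

Lemma mem_span (V : lmodType K) (G : V -> Prop) y : G y -> y \in span G.
Proof. by move=> Gy; apply/asboolP => S; apply. Qed.

Lemma preim_submod (V W : lmodType K) (f : {linear V -> W}) (S : subspace W) :
  submod_closed [pred v | f v \in S].
Proof.
split=> [|a u v]; rewrite !inE ?raddf0 ?rpred0 // => hu hv.
by rewrite linearP rpredD // rpredZ.
Qed.

End Subspaces.

(* The quotient vector space V / S. *)
Definition lquot (K : fieldType) (V : lmodType K) (S : subspace V) : Type :=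
  Quotient.quot (subspace_pred S : zmodClosed V).
HB.instance Definition _ (K : fieldType) (V : lmodType K) (S : subspace V) :=
  GRing.Zmodule.on (lquot S).

HB.lock Definition lpi (K : fieldType) (V : lmodType K) (S : subspace V)
  (v : V) : lquot S := \pi_(Quotient.quot (subspace_pred S : zmodClosed V)) v.

HB.lock Definition lrepr (K : fieldType) (V : lmodType K) (S : subspace V)
  (q : lquot S) : V := repr (q : Quotient.quot (subspace_pred S : zmodClosed V)).

HB.lock Definition lscale (K : fieldType) (V : lmodType K) (S : subspace V)
  (a : K) (q : lquot S) : lquot S := lpi S (a *: lrepr q).

(* The map on V / S induced by a linear endomorphism of V preserving S. *)
HB.lock Definition qmap (K : fieldType) (V : lmodType K) (S : subspace V)
  (f : V -> V) (q : lquot S) : lquot S := lpi S (f (lrepr q)).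

Section Quotient.
Context {K : fieldType} {V : lmodType K} (S : subspace V).
Local Notation lquot := (lquot S).
Local Notation lpi := (@lpi K V S).
Local Notation lrepr := (@lrepr K V S).
Local Notation lscale := (@lscale K V S).
Local Notation qmap := (@qmap K V S).

Lemma lreprK q : lpi (lrepr q) = q. Proof. by rewrite lpi.unlock lrepr.unlock; apply: reprK. Qed.

Lemma lpiP u v : reflect (lpi u = lpi v) (u - v \in S).
Proof. by rewrite lpi.unlock Quotient.idealrBE; apply: eqP. Qed.

Lemma lpiD u v : lpi (u + v) = lpi u + lpi v.
Proof. by rewrite lpi.unlock; exact: (raddfD \pi_(Quotient.quot (subspace_pred S : zmodClosed V))). Qed.

Lemma lrepr_lpi v : lrepr (lpi v) - v \in S.
Proof. by apply/lpiP; rewrite lreprK. Qed.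

Lemma lscaleE a v : lscale a (lpi v) = lpi (a *: v).
Proof.
by rewrite lscale.unlock; apply/lpiP; rewrite -scalerBr rpredZ // lrepr_lpi.
Qed.

Lemma lscaleA a b q : lscale a (lscale b q) = lscale (a * b) q.
Proof. by rewrite -[q]lreprK !lscaleE scalerA. Qed.
Lemma lscale1 : left_id 1 lscale.
Proof. by move=> q; rewrite -[q]lreprK lscaleE scale1r. Qed.
Lemma lscaleDr : right_distributive lscale +%R.
Proof.
by move=> a p q; rewrite -[p]lreprK -[q]lreprK -lpiD !lscaleE -lpiD scalerDr.
Qed.
Lemma lscaleDl q : {morph lscale^~ q : a b / a + b}.
Proof. by move=> a b; rewrite -[q]lreprK !lscaleE -lpiD scalerDl. Qed.

HB.instance Definition _ := GRing.Zmodule_isLmodule.Build K lquot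
  lscaleA lscale1 lscaleDr lscaleDl.

Lemma lpi_linear : linear lpi.
Proof. by move=> a u v; rewrite lpiD; congr (_ + _); rewrite -lscaleE. Qed.

HB.instance Definition _ := GRing.isLinear.Build K V lquot *:%R lpi lpi_linear.

Lemma lpi_eq0 v : (lpi v == 0) = (v \in S).
Proof.
by rewrite -(linear0 lpi); apply/eqP/idP => [/lpiP|vS]; [|apply/lpiP]; rewrite subr0.
Qed.

Lemma qmapE (f : V -> V) v : linear f -> {in S, forall v, f v \in S} ->
  qmap f (lpi v) = lpi (f v).
Proof.
move=> lf fS; rewrite qmap.unlock; apply/lpiP; have fB u w : f (u - w) = f u - f w.
  by rewrite addrC -scaleN1r lf scaleN1r addrC.
by rewrite -fB fS // lrepr_lpi.
Qed.

End Quotient.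

HB.mixin Record Lmodule_isLieAlgebra (K : fieldType) L of GRing.Lmodule K L := {
  lie : L -> L -> L;
  lie_linearl : forall y, linear (lie ^~ y);
  lie_linearr : forall x, linear (lie x);
  liexx : forall x, lie x x = 0;
  lie_jacobi : forall x y z,
    lie x (lie y z) + lie y (lie z x) + lie z (lie x y) = 0
}.

#[short(type="lieAlgType")]
HB.structure Definition LieAlgebra (K : fieldType) :=
  {L of GRing.Lmodule K L & Lmodule_isLieAlgebra K L}.

HB.mixin Record Lmodule_isLieModule (K : fieldType) (L : lieAlgType K) V
    of GRing.Lmodule K V := {
  act : L -> V -> V;
  act_linearl : forall v, linear (act ^~ v);
  act_linearr : forall x, linear (act x);
  act_lie : forall x y v, act (lie x y) v = act x (act y v) - act y (act x v)
}.

#[short(type="lieModType")]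
HB.structure Definition LieModule (K : fieldType) (L : lieAlgType K) :=
  {V of GRing.Lmodule K V & Lmodule_isLieModule K L V}.

Section LieModules.
Context {K : fieldType} {L : lieAlgType K}.

HB.instance Definition _ (V : lieModType L) x :=
  GRing.isLinear.Build K V V *:%R (@act K L V x) (act_linearr x).

Record submodule (V : lieModType L) := Submodule {
  submodule_subspace :> subspace V;
  submodule_act : forall x, {in submodule_subspace, forall v,
    act x v \in submodule_subspace}
}.

Lemma gen_subproof (V : lieModType L) (G : V -> Prop) x :
  let S := Subspace (cap_submod (@submodule_subspace V)
    (fun N => forall y, G y -> y \in N)) in
  {in S, forall v, act x v \in S}.
Proof.
move=> S v /asboolP vS; apply/asboolP => N GN.
by apply: submodule_act; apply: vS.
Qed.

Definition submodule_gen (V : lieModType L) (G : V -> Prop) : submodule V :=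
  Submodule (@gen_subproof V G).

Definition maximal_submodule (V : lieModType L) (J : submodule V) : Prop :=
  (exists v, v \notin J) /\
  forall N : submodule V, (exists v, v \notin N) -> {subset J <= N} -> N =i J.

(* The zero module counts neither as reducible nor as irreducible. *)
Definition reducible (V : lieModType L) : Prop :=
  exists N : submodule V, (exists2 v, v \in N & v != 0) /\ (exists v, v \notin N).

Section QuotientModule.
Context {V : lieModType L} (N : submodule V).

Definition mquot : Type := lquot N.
HB.instance Definition _ := GRing.Lmodule.on mquot.

Definition mquot_act (x : L) : mquot -> mquot := qmap (S := N) (act x).

Lemma mquot_actE x v : mquot_act x (lpi N v) = lpi N (act x v).
Proof. by apply: qmapE; [apply: act_linearr | apply: submodule_act]. Qed.

Lemma mquot_act_linearl q : linear (mquot_act ^~ q).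
Proof.
move=> a x y; rewrite -[q]lreprK !mquot_actE act_linearl.
exact: lpi_linear.
Qed.

Lemma mquot_act_linearr x : linear (mquot_act x).
Proof.
move=> a p q; rewrite -[p]lreprK -[q]lreprK.
by rewrite -(lpi_linear N) !mquot_actE act_linearr; apply: lpi_linear.
Qed.

Lemma mquot_act_lie x y q : mquot_act (lie x y) q =
  mquot_act x (mquot_act y q) - mquot_act y (mquot_act x q).
Proof. by rewrite -[q]lreprK !mquot_actE act_lie; apply: (linearB (lpi N)). Qed.

HB.instance Definition _ := Lmodule_isLieModule.Build K L mquot
  mquot_act_linearl mquot_act_linearr mquot_act_lie.

End QuotientModule.

Section SubModule.
Context {V : lieModType L} (N : submodule V).

Definition msub : Type := {v : V | v \in N}.
HB.instance Definition _ := Choice.on msub.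
HB.instance Definition _ := SubType.on msub.
HB.instance Definition _ :=
  @GRing.SubChoice_isSubLmodule.Build K V (mem N) msub
    (GRing.submod_closed_semi (subspaceP N)).

Definition msub_act (x : L) (v : msub) : msub :=
  exist _ (act x (val v)) (submodule_act x (valP v)).

Lemma msub_act_linearl v : linear (msub_act ^~ v).
Proof. by move=> a x y; apply: val_inj; rewrite linearP /= act_linearl. Qed.
Lemma msub_act_linearr x : linear (msub_act x).
Proof. by move=> a u v; apply: val_inj; rewrite [RHS]linearP /= linearP. Qed.
Lemma msub_act_lie x y v : msub_act (lie x y) v =
  msub_act x (msub_act y v) - msub_act y (msub_act x v).
Proof. by apply: val_inj; rewrite linearB /= act_lie. Qed.

HB.instance Definition _ := Lmodule_isLieModule.Build K L msub
  msub_act_linearl msub_act_linearr msub_act_lie.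

End SubModule.

(* The tensor product of V and W over K: the vector space with basis V * W    *)
(* modulo bilinearity, the class of << (v, w) >> being v (x) w.               *)
Section Tensor.
Context (V W : lieModType L).

Variant tensor_rel : {malg K[(V * W)%type]} -> Prop :=
| TensorLinl a v v' w : tensor_rel
    (<< (a *: v + v', w) >> - (a *: << (v, w) >> + << (v', w) >>))
| TensorLinr a v w w' : tensor_rel
    (<< (v, a *: w + w') >> - (a *: << (v, w) >> + << (v, w') >>)).

Definition tensor : Type := lquot (span tensor_rel).
HB.instance Definition _ := GRing.Lmodule.on tensor.

Definition tens (v : V) (w : W) : tensor := lpi (span tensor_rel) << (v, w) >>.

Definition free_act (x : L) : {malg K[(V * W)%type]} -> {malg K[(V * W)%type]} :=
  lext (fun p => << (act x p.1, p.2) >> + << (p.1, act x p.2) >>).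

Definition tensor_act (x : L) : tensor -> tensor :=
  qmap (S := span tensor_rel) (free_act x).

Lemma tens_linearl w : linear (tens ^~ w).
Proof.
move=> a v v'; rewrite /tens.
rewrite -[RHS](lpi_linear (span tensor_rel)).
by apply/lpiP; apply: mem_span; apply: TensorLinl.
Qed.

Lemma tens_linearr v : linear (tens v).
Proof.
move=> a w w'; rewrite /tens.
rewrite -[RHS](lpi_linear (span tensor_rel)).
by apply/lpiP; apply: mem_span; apply: TensorLinr.
Qed.

Lemma lpi_free_act x v w :
  lpi (span tensor_rel) (free_act x << (v, w) >>) =
  tens (act x v) w + tens v (act x w).
Proof. by rewrite /free_act lextU lpiD. Qed.

Lemma free_act_span x :
  {in span tensor_rel, forall p, free_act x p \in span tensor_rel}.
Proof.
pose g : {linear {malg K[(V * W)%type]} -> lquot (span tensor_rel)} :=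
  lpi (span tensor_rel) \o lext (fun p : V * W =>
    << (act x p.1, p.2) >> + << (p.1, act x p.2) >> : {malg K[(V * W)%type]}).
have gE v w : g << (v, w) >> = tens (act x v) w + tens v (act x w).
  exact: lpi_free_act.
have g3 a A B C : g (A - (a *: B + C)) = g A - (a *: g B + g C).
  by rewrite linearB linearP.
apply: (span_sub (S := Subspace (preim_submod (lext _) (span tensor_rel)))) => y hy.
rewrite inE -lpi_eq0; change (g y == 0).
case: hy => [a v v' w|a v w w']; rewrite g3 !gE act_linearr subr_eq0.
  by rewrite !tens_linearl scalerDr addrACA.
by rewrite !tens_linearr scalerDr addrACA.
Qed.

Lemma tensor_actE x p :
  tensor_act x (lpi (span tensor_rel) p) = lpi (span tensor_rel) (free_act x p).
Proof. by apply: qmapE; [apply: lext_linear | apply: free_act_span]. Qed.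

Lemma tensor_act_tens x v w :
  tensor_act x (tens v w) = tens (act x v) w + tens v (act x w).
Proof. by rewrite /tens tensor_actE lpi_free_act. Qed.

Lemma tensor_act_linearr x : linear (tensor_act x).
Proof.
move=> a p q; rewrite -[p]lreprK -[q]lreprK.
rewrite -(lpi_linear (span tensor_rel)) !tensor_actE /free_act lext_linear.
exact: lpi_linear.
Qed.

HB.instance Definition _ x :=
  GRing.isLinear.Build K tensor tensor *:%R (tensor_act x) (tensor_act_linearr x).

Lemma tensor_act0 x : tensor_act x 0 = 0.
Proof. exact: linear0. Qed.

Lemma tensor_ind (P : tensor -> Prop) :
  P 0 -> (forall a p q, P p -> P q -> P (a *: p + q)) ->
  (forall v w, P (tens v w)) -> forall p, P p.
Proof.
move=> P0 PD PT p; rewrite -[p]lreprK; move: (lrepr p); apply: malg_lind.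
- by rewrite linear0.
- by move=> a x y; rewrite linearP; apply: PD.
- by case=> v w; apply: PT.
Qed.

Lemma tensor_act_linearl p : linear (tensor_act ^~ p).
Proof.
move=> a x y; elim/tensor_ind: p => [|b p q hp hq|v w].
- by rewrite !tensor_act0 scaler0 addr0.
- by rewrite !tensor_act_linearr hp hq !scalerDr !scalerA mulrC addrACA.
- by rewrite !tensor_act_tens !act_linearl tens_linearl tens_linearr
    scalerDr addrACA.
Qed.

Lemma tensor_zmod (Z : zmodType) (a b c d e f : Z) :
  a - b + (c - d) = a + e + (f + c) - (b + f + (e + d)).
Proof.
rewrite [f + c]addrC [a + e + _]addrACA [e + d]addrC [b + f + _]addrACA.
by rewrite [f + e]addrC [in RHS]opprD [RHS]addrACA subrr addr0 opprD addrACA.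
Qed.

Lemma tensor_act_lie x y p : tensor_act (lie x y) p =
  tensor_act x (tensor_act y p) - tensor_act y (tensor_act x p).
Proof.
elim/tensor_ind: p => [|b p q hp hq|v w].
- by rewrite !tensor_act0 subr0.
- by rewrite !tensor_act_linearr hp hq scalerBr opprD addrACA.
- have tBl u u' w' : tens (u - u') w' = tens u w' - tens u' w'.
    by rewrite addrC -scaleN1r tens_linearl scaleN1r addrC.
  have tBr v' u u' : tens v' (u - u') = tens v' u - tens v' u'.
    by rewrite addrC -scaleN1r tens_linearr scaleN1r addrC.
  rewrite !tensor_act_tens !(linearD (tensor_act _)) /= !tensor_act_tens.
  rewrite !act_lie tBl tBr.
  exact: tensor_zmod.
Qed.

HB.instance Definition _ := Lmodule_isLieModule.Build K L tensor
  tensor_act_linearl tensor_act_linearr tensor_act_lie.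

End Tensor.
End LieModules.

Section Ideals.
Context {K : fieldType}.

Record ideal (A : lalgType K) := Ideal {
  ideal_subspace :> subspace A;
  idealMl : forall a, {in ideal_subspace, forall x, a * x \in ideal_subspace};
  idealMr : forall a, {in ideal_subspace, forall x, x * a \in ideal_subspace}
}.

Record leftIdeal (A : lalgType K) := LeftIdeal {
  leftIdeal_subspace :> subspace A;
  leftIdealMl : forall a, {in leftIdeal_subspace, forall x,
    a * x \in leftIdeal_subspace}
}.

Section Generated.
Variables (A : lalgType K) (G : A -> Prop).

Let ideal_cap := Subspace (cap_submod (@ideal_subspace A)
  (fun I => forall y, G y -> y \in I)).
Let leftIdeal_cap := Subspace (cap_submod (@leftIdeal_subspace A)
  (fun I => forall y, G y -> y \in I)).

Lemma ideal_genMl a : {in ideal_cap, forall x, a * x \in ideal_cap}.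
Proof.
move=> x /asboolP xI; apply/asboolP => I GI.
by apply: idealMl; apply: xI.
Qed.

Lemma ideal_genMr a : {in ideal_cap, forall x, x * a \in ideal_cap}.
Proof.
move=> x /asboolP xI; apply/asboolP => I GI.
by apply: idealMr; apply: xI.
Qed.

Lemma leftIdeal_genMl a : {in leftIdeal_cap, forall x, a * x \in leftIdeal_cap}.
Proof.
move=> x /asboolP xI; apply/asboolP => I GI.
by apply: leftIdealMl; apply: xI.
Qed.

Definition ideal_gen : ideal A := Ideal ideal_genMl ideal_genMr.
Definition leftIdeal_gen : leftIdeal A := LeftIdeal leftIdeal_genMl.

Lemma mem_ideal_gen y : G y -> y \in ideal_gen.
Proof. by move=> Gy; apply/asboolP => I; apply. Qed.

Lemma mem_leftIdeal_gen y : G y -> y \in leftIdeal_gen.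
Proof. by move=> Gy; apply/asboolP => I; apply. Qed.

End Generated.

End Ideals.

Section EnvelopingAlgebra.
Context {K : fieldType} (L : lieAlgType K).

(* The relations uea_add make the free associative algebra on the underlying  *)
(* set of L into the tensor algebra of the vector space L.                    *)
Variant uea_rel : {malg K[{fmonom L}]} -> Prop :=
| uea_add a x y : uea_rel
    (<< fmu (a *: x + y) >> - (a *: << fmu x >> + << fmu y >>))
| uea_lie x y : uea_rel
    (<< fmu x >> * << fmu y >> - << fmu y >> * << fmu x >> - << fmu (lie x y) >>).

Definition uea_ideal : ideal {malg K[{fmonom L}]} := ideal_gen uea_rel.

Definition uea : Type := lquot uea_ideal.
HB.instance Definition _ := GRing.Lmodule.on uea.

Definition uea_pi : {malg K[{fmonom L}]} -> uea := lpi uea_ideal.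
Definition uea_repr : uea -> {malg K[{fmonom L}]} := @lrepr _ _ uea_ideal.

End EnvelopingAlgebra.

HB.lock Definition uea_mul (K : fieldType) (L : lieAlgType K) (p q : uea L) :
  uea L := uea_pi (uea_repr p * uea_repr q).

Section EnvelopingAlgebraTheory.
Context {K : fieldType} (L : lieAlgType K).
Local Notation uea := (uea L).
Local Notation uea_ideal := (uea_ideal L).
Local Notation uea_pi := (@uea_pi K L).
Local Notation uea_mul := (@uea_mul K L).

Definition uea_one : uea := uea_pi 1.

Lemma uea_mulE a b : uea_mul (uea_pi a) (uea_pi b) = uea_pi (a * b).
Proof.
rewrite uea_mul.unlock; apply/lpiP; set a' := uea_repr _; set b' := uea_repr _.
have -> : a' * b' - a * b = (a' - a) * b' + a * (b' - b).
  by rewrite mulrBl mulrBr addrA subrK.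
by apply: rpredD; [apply: idealMr | apply: idealMl]; apply: lrepr_lpi.
Qed.

Lemma uea_mulA : associative uea_mul.
Proof.
move=> p q r; rewrite -[p]lreprK -[q]lreprK -[r]lreprK -!/(uea_pi _).
by rewrite !uea_mulE mulrA.
Qed.
Lemma uea_mul1 : left_id uea_one uea_mul.
Proof. by move=> p; rewrite -[p]lreprK -!/(uea_pi _) uea_mulE mul1r. Qed.
Lemma uea_mulr1 : right_id uea_one uea_mul.
Proof. by move=> p; rewrite -[p]lreprK -!/(uea_pi _) uea_mulE mulr1. Qed.
Lemma uea_mulDl : left_distributive uea_mul +%R.
Proof.
move=> p q r; rewrite -[p]lreprK -[q]lreprK -[r]lreprK -!/(uea_pi _).
by rewrite -lpiD -!/(uea_pi _) !uea_mulE mulrDl -lpiD.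
Qed.
Lemma uea_mulDr : right_distributive uea_mul +%R.
Proof.
move=> p q r; rewrite -[p]lreprK -[q]lreprK -[r]lreprK -!/(uea_pi _).
by rewrite -lpiD -!/(uea_pi _) !uea_mulE mulrDr -lpiD.
Qed.

Lemma uea_counit (r : {malg K[{fmonom L}]}) : r \in uea_ideal -> r@_mone = 0.
Proof.
have cap : submod_closed [pred p : {malg K[{fmonom L}]} | p@_mone == 0].
  split=> [|a p q]; rewrite !inE ?mcoeff0 // => /eqP hp /eqP hq.
  by rewrite mcoeffD mcoeffZ hp hq mulr0 addr0.
have capM a p : p@_mone = 0 -> (a * p : {malg K[{fmonom L}]})@_mone = 0.
  by move=> hp; rewrite rmorphM /= hp mulr0.
have capM' a p : p@_mone = 0 -> (p * a : {malg K[{fmonom L}]})@_mone = 0.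
  by move=> hp; rewrite rmorphM /= hp mul0r.
have Il a : {in Subspace cap, forall p, a * p \in Subspace cap}.
  by move=> p /eqP hp; apply/eqP; apply: capM.
have Ir a : {in Subspace cap, forall p, p * a \in Subspace cap}.
  by move=> p /eqP hp; apply/eqP; apply: capM'.
move=> /asboolP /(_ (Ideal Il Ir)) hp; apply/eqP; apply: hp => y hy.
have U0 x : (<< fmu x >> : {malg K[{fmonom L}]})@_mone = 0.
  rewrite mcoeffU; case: eqP => // /(congr1 (@fmonom_val L)).
  by rewrite fmuE fm1.
have mM p q : (p * q : {malg K[{fmonom L}]})@_mone = p@_mone * q@_mone.
  exact: rmorphM.
have e1 (k : K) (A B C : {malg K[{fmonom L}]}) :
    A@_mone = 0 -> B@_mone = 0 -> C@_mone = 0 -> (A - (k *: B + C))@_mone = 0.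
  by move=> A0 B0 C0; rewrite mcoeffB mcoeffD mcoeffZ A0 B0 C0 mulr0 addr0 subr0.
have e2 (A B C : {malg K[{fmonom L}]}) :
    A@_mone = 0 -> B@_mone = 0 -> C@_mone = 0 -> (A * B - B * A - C)@_mone = 0.
  move=> A0 B0 C0; rewrite mcoeffB (mcoeffB _ (A * B)) (capM A B B0).
  by rewrite (capM B A A0) C0 !subr0.
apply/eqP; case: hy => [a x z|x z]; [apply: e1 | apply: e2]; exact: U0.
Qed.

Lemma uea_one_neq0 : uea_one != 0.
Proof.
rewrite /uea_one /uea_pi lpi_eq0; apply/negP => /uea_counit /eqP.
by rewrite rmorph1 oner_eq0.
Qed.

HB.instance Definition _ := GRing.Zmodule_isNzRing.Build uea
  uea_mulA uea_mul1 uea_mulr1 uea_mulDl uea_mulDr uea_one_neq0.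

Lemma uea_piM a b : uea_pi (a * b) = uea_pi a * uea_pi b.
Proof. by rewrite -uea_mulE. Qed.

Lemma uea_piZ k a : uea_pi (k *: a) = k *: uea_pi a.
Proof. exact: (linearZ_LR (lpi uea_ideal)). Qed.

Lemma uea_scaleAl k (p q : uea) : k *: (p * q) = (k *: p) * q.
Proof.
rewrite -[p]lreprK -[q]lreprK -!/(uea_pi _) -uea_piZ -!uea_piM -uea_piZ.
by rewrite scalerAl.
Qed.

Lemma malg_scaleAr k (a b : {malg K[{fmonom L}]}) : k *: (a * b) = a * (k *: b).
Proof.
rewrite malgME (malgMEw (fsubset_refl _) (msuppZ_le k b)) scaler_sumr.
apply: eq_bigr => i _; rewrite scaler_sumr; apply: eq_bigr => j _.
by rewrite malgU_scale mcoeffZ mulrCA.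
Qed.

Lemma uea_scaleAr k (p q : uea) : k *: (p * q) = p * (k *: q).
Proof.
rewrite -[p]lreprK -[q]lreprK -!/(uea_pi _) -uea_piZ -!uea_piM -uea_piZ.
by rewrite malg_scaleAr.
Qed.

HB.instance Definition _ := GRing.Lmodule_isLalgebra.Build K uea uea_scaleAl.
HB.instance Definition _ := GRing.Lalgebra_isAlgebra.Build K uea uea_scaleAr.

Definition uea_in (x : L) : uea := uea_pi << fmu x >>.

Lemma uea_in_linear : linear uea_in.
Proof.
move=> a x y; rewrite /uea_in -[RHS](lpi_linear uea_ideal).
by apply/lpiP; apply: mem_ideal_gen; apply: uea_add.
Qed.

Lemma uea_in_lie x y :
  uea_in (lie x y) = uea_in x * uea_in y - uea_in y * uea_in x.
Proof.
rewrite /uea_in -!uea_piM -[RHS](linearB (lpi uea_ideal)); symmetry.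
by apply/lpiP; apply: mem_ideal_gen; apply: uea_lie.
Qed.

Definition uea_act (x : L) (u : uea) : uea := uea_in x * u.

Lemma uea_act_linearl u : linear (uea_act ^~ u).
Proof. by move=> a x y; rewrite /uea_act uea_in_linear mulrDl scalerAl. Qed.
Lemma uea_act_linearr x : linear (uea_act x).
Proof. by move=> a u v; rewrite /uea_act mulrDr scalerAr. Qed.
Lemma uea_act_lie x y u :
  uea_act (lie x y) u = uea_act x (uea_act y u) - uea_act y (uea_act x u).
Proof. by rewrite /uea_act uea_in_lie mulrBl !mulrA. Qed.

HB.instance Definition _ := Lmodule_isLieModule.Build K L uea
  uea_act_linearl uea_act_linearr uea_act_lie.

Definition leftIdeal_submodule (I : leftIdeal uea) : submodule uea :=
  @Submodule K L uea I (fun x => @leftIdealMl K uea I (uea_in x)).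

End EnvelopingAlgebraTheory.

Variant W22_basis := BL of int | BW of int | BC.

Definition W22_basis_code (i : W22_basis) : int + int + unit :=
  match i with BL n => inl (inl n) | BW n => inl (inr n) | BC => inr tt end.
Definition W22_basis_decode (s : int + int + unit) : W22_basis :=
  match s with inl (inl n) => BL n | inl (inr n) => BW n | inr _ => BC end.
Lemma W22_basis_codeK : cancel W22_basis_code W22_basis_decode.
Proof. by case. Qed.
HB.instance Definition _ := Choice.copy W22_basis (can_type W22_basis_codeK).

Definition W22 (K : fieldType) : Type := {malg K[W22_basis]}.
HB.instance Definition _ (K : fieldType) := GRing.Lmodule.on (W22 K).

HB.lock Definition W22_e (K : fieldType) (i : W22_basis) : W22 K := << i >>.

Section W22.
Context {K : fieldType}.
Local Notation W22 := (W22 K).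
Local Notation W22_e := (@W22_e K).

Definition eL (n : int) : W22 := W22_e (BL n).
Definition eW (n : int) : W22 := W22_e (BW n).
Definition eC : W22 := W22_e BC.

Lemma W22_ind (P : W22 -> Prop) : P 0 ->
  (forall a x y, P x -> P y -> P (a *: x + y)) -> (forall i, P (W22_e i)) ->
  forall x, P x.
Proof.
by move=> P0 PD PU; apply: malg_lind => // i; have := PU i; rewrite W22_e.unlock.
Qed.

(* [L_n, X_m] for X = L or X = W. *)
Definition W22_LX (X : int -> W22) (n m : int) : W22 :=
  (n - m)%:~R *: X (n + m) +
  (if n == - m then (n ^+ 3 - n)%:~R / 12%:R else 0) *: eC.

Definition W22_brac (i j : W22_basis) : W22 :=
  match i, j with
  | BL n, BL m => W22_LX eL n m
  | BL n, BW m => W22_LX eW n m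
  | BW n, BL m => - W22_LX eW m n
  | _, _ => 0
  end.

Definition W22_lie : W22 -> W22 -> W22 := bext W22_brac.

Lemma W22_LXC X n m : W22_LX X m n = - W22_LX X n m.
Proof.
rewrite /W22_LX opprD -!scaleNr -rmorphN opprB addrC [m + n]addrC addrC.
congr (_ + _ *: _); rewrite (eq_sym m) eqr_oppLR.
case: eqP => [->|_]; rewrite ?oppr0 // -mulNr -rmorphN /=.
by congr (_%:~R / _); ring.
Qed.

Lemma W22_bracC i j : W22_brac j i = - W22_brac i j.
Proof. by case: i j => [n|n|] [m|m|] /=; rewrite ?oppr0 ?opprK -?W22_LXC. Qed.

Lemma W22_lie_linearl y : linear (W22_lie ^~ y).
Proof. exact: bext_linearl. Qed.
Lemma W22_lie_linearr x : linear (W22_lie x).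
Proof. exact: bext_linearr. Qed.

Lemma W22_lieUU i j : W22_lie (W22_e i) (W22_e j) = W22_brac i j.
Proof. by rewrite W22_e.unlock; apply: bextUU. Qed.

Lemma W22_lie0l y : W22_lie 0 y = 0.
Proof. exact: (linear0 (lext _)). Qed.

Lemma W22_lie0r x : W22_lie x 0 = 0.
Proof.
by have := W22_lie_linearr x (-1) 0 0; rewrite scaler0 addr0 scaleN1r addNr.
Qed.

Lemma W22_lie_lin2 x a b u v :
  W22_lie x (a *: u + b *: v) = a *: W22_lie x u + b *: W22_lie x v.
Proof. by rewrite W22_lie_linearr -[b *: v]addr0 W22_lie_linearr W22_lie0r addr0. Qed.

Lemma W22_lieC x y : W22_lie y x = - W22_lie x y.
Proof.
elim/W22_ind: x => [|a x x' hx hx'|i].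
- by rewrite W22_lie0r W22_lie0l oppr0.
- by rewrite W22_lie_linearr W22_lie_linearl hx hx' opprD scalerN.
elim/W22_ind: y => [|a y y' hy hy'|j].
- by rewrite W22_lie0r W22_lie0l oppr0.
- by rewrite W22_lie_linearr W22_lie_linearl hy hy' opprD scalerN.
by rewrite !W22_lieUU W22_bracC.
Qed.

Lemma W22_liexx x : W22_lie x x = 0.
Proof.
elim/W22_ind: x => [|a x y hx hy|i].
- by rewrite W22_lie0r.
- rewrite W22_lie_linearr !W22_lie_linearl hx hy scaler0 add0r addr0.
  by rewrite [X in _ *: X]W22_lieC scalerN addNr.
rewrite W22_lieUU; case: i => [n|n|] //=.
rewrite /W22_LX subrr scale0r add0r; case: eqP => [nN|_]; last by rewrite scale0r.
suff -> : n = 0 by rewrite expr0n subrr mul0r scale0r.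
have : n *+ 2 == 0 by rewrite mulr2n {1}nN addNr.
by rewrite mulrn_eq0 => /eqP.
Qed.

Lemma W22_lie_LX X n m :
  (forall k, W22_lie (eL n) (X k) = W22_LX X n k) -> forall k,
  W22_lie (eL n) (W22_LX X m k) = (m - k)%:~R *: W22_LX X n (m + k).
Proof.
move=> hX k; rewrite {1}/W22_LX W22_lie_lin2 hX.
by rewrite W22_lieUU scaler0 addr0.
Qed.

Lemma W22_lie_WX n m k :
  W22_lie (eW n) (W22_LX eL m k) = - ((m - k)%:~R *: W22_LX eW (m + k) n).
Proof.
rewrite {1}/W22_LX W22_lie_lin2 !W22_lieUU /= scaler0 addr0.
by rewrite scalerN.
Qed.

Lemma W22_lie_WW n m k : W22_lie (eW n) (W22_LX eW m k) = 0.
Proof. by rewrite /W22_LX W22_lie_lin2 !W22_lieUU /= !scaler0 addr0. Qed.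

Lemma W22_lie_C x : W22_lie eC x = 0.
Proof.
elim/W22_ind: x => [|a x y hx hy|i]; first by rewrite W22_lie0r.
  by rewrite W22_lie_linearr hx hy scaler0 addr0.
by rewrite W22_lieUU.
Qed.

Lemma W22_LX_jacobi X n m k :
  (m - k)%:~R *: W22_LX X n (m + k) + (k - n)%:~R *: W22_LX X m (k + n) +
  (n - m)%:~R *: W22_LX X k (n + m) = 0.
Proof.
have split3 (a1 a2 a3 b1 b2 b3 : K) (u v : W22) :
    (a1 *: u + b1 *: v) + (a2 *: u + b2 *: v) + (a3 *: u + b3 *: v) =
    (a1 + a2 + a3) *: u + (b1 + b2 + b3) *: v.
  by rewrite !scalerDl (addrACA (a1 *: u)) [LHS]addrACA.
rewrite /W22_LX !scalerDr !scalerA.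
have -> : m + (k + n) = n + (m + k) by ring.
have -> : k + (n + m) = n + (m + k) by ring.
rewrite split3 -!rmorphM -!rmorphD /=.
have -> : (m - k) * (n - (m + k)) + (k - n) * (m - (k + n)) +
          (n - m) * (k - (n + m)) = 0 by ring.
rewrite scale0r add0r -[n == _]addr_eq0 -[m == _]addr_eq0 -[k == _]addr_eq0.
have -> : m + (k + n) = n + (m + k) by ring.
have -> : k + (n + m) = n + (m + k) by ring.
rewrite addr_eq0; case: eqP => [->|_]; last by rewrite !mulr0 !addr0 scale0r.
rewrite !mulrA -!mulrDl -!rmorphM -!rmorphD /=.
rewrite (_ : _ + _ = 0) ?mul0r ?scale0r //; ring.
Qed.

Lemma W22_lieN x y : W22_lie x (- y) = - W22_lie x y.
Proof. by rewrite -scaleN1r -[_ *: y]addr0 W22_lie_linearr W22_lie0r addr0 scaleN1r. Qed.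

Lemma W22_lie_jacobi x y z : W22_lie x (W22_lie y z) +
  W22_lie y (W22_lie z x) + W22_lie z (W22_lie x y) = 0.
Proof.
have step (a : K) (u1 u2 u3 v1 v2 v3 : W22) :
    u1 + u2 + u3 = 0 -> v1 + v2 + v3 = 0 ->
    (a *: u1 + v1) + (a *: u2 + v2) + (a *: u3 + v3) = 0.
  move=> hu hv; transitivity (a *: (u1 + u2 + u3) + (v1 + v2 + v3)).
    by rewrite !scalerDr (addrACA (a *: u1)) [LHS]addrACA.
  by rewrite hu hv scaler0 addr0.
have L0 := W22_lie0r.
elim/W22_ind: x => [|a x x' hx hx'|i].
- by rewrite !(L0, W22_lie0l) !addr0.
- by rewrite !(W22_lie_linearl, W22_lie_linearr) step.
elim/W22_ind: y => [|a y y' hy hy'|j].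
- by rewrite !(L0, W22_lie0l) !addr0.
- by rewrite !(W22_lie_linearl, W22_lie_linearr) step.
elim/W22_ind: z => [|a z z' hz hz'|k].
- by rewrite !(L0, W22_lie0l) !addr0.
- by rewrite !(W22_lie_linearl, W22_lie_linearr) step.
have hL n m : W22_lie (eL n) (eL m) = W22_LX eL n m by apply: W22_lieUU.
have hW n m : W22_lie (eL n) (eW m) = W22_LX eW n m by apply: W22_lieUU.
have hW' n m : W22_lie (eW n) (eL m) = W22_LX eW n m.
  by rewrite W22_LXC; apply: W22_lieUU.
have hWW n m : W22_lie (eW n) (eW m) = 0 by apply: W22_lieUU.
pose J u v w := W22_lie u (W22_lie v w) + W22_lie v (W22_lie w u) +
  W22_lie w (W22_lie u v) = 0.
have rot u v w : J u v w -> J v w u by rewrite /J => <-; rewrite addrC addrA.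
have LLL n m p : J (eL n) (eL m) (eL p).
  rewrite /J (hL m) (hL p) (hL n) (W22_lie_LX m (hL n)) (W22_lie_LX p (hL m)).
  by rewrite (W22_lie_LX n (hL p)) W22_LX_jacobi.
have LLW n m p : J (eL n) (eL m) (eW p).
  rewrite /J (hW m) (hW' p) (hL n) (W22_lie_LX m (hW n)) (W22_lie_LX p (hW m)).
  by rewrite W22_lie_WX -scalerN -W22_LXC W22_LX_jacobi.
have LWW n m p : J (eL n) (eW m) (eW p).
  by rewrite /J (hWW m) (hW' p) (hW n) !W22_lie_WW L0 !addr0.
have WWW n m p : J (eW n) (eW m) (eW p).
  by rewrite /J (hWW m) (hWW p) (hWW n) !L0 !addr0.
have CJ u v : J eC u v.
  rewrite /J (W22_lie_C u) (W22_lieC eC v) !W22_lie_C oppr0 !L0.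
  by rewrite !addr0.
case: i j k => [n|n|] [m|m|] [p|p|].
- exact: LLL.
- exact: LLW.
- exact: rot (CJ _ _).
- exact: rot (LLW _ _ _).
- exact: LWW.
- exact: rot (CJ _ _).
- exact: rot (rot _ _ _ (CJ _ _)).
- exact: rot (rot _ _ _ (CJ _ _)).
- exact: rot (rot _ _ _ (CJ _ _)).
- exact: rot (rot _ _ _ (LLW _ _ _)).
- exact: rot (rot _ _ _ (LWW _ _ _)).
- exact: rot (CJ _ _).
- exact: rot (LWW _ _ _).
- exact: WWW.
- exact: rot (CJ _ _).
- exact: rot (rot _ _ _ (CJ _ _)).
- exact: rot (rot _ _ _ (CJ _ _)).
- exact: rot (rot _ _ _ (CJ _ _)).
all: exact: CJ.
Qed.

HB.instance Definition _ := Lmodule_isLieAlgebra.Build K W22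
  W22_lie_linearl W22_lie_linearr W22_liexx W22_lie_jacobi.

End W22.

Section IntermediateSeries.
Context {K : fieldType}.

(* V_{al,be,0}; the basis vector v_m is << m >>. *)
Definition intser (al be : K) : Type := {malg K[int]}.
HB.instance Definition _ al be := GRing.Lmodule.on (intser al be).

Section Action.
Variables al be : K.

Definition intser_v (m : int) : intser al be := << m >>.

Definition intser_coef (n m : int) : K :=
  - (m%:~R + al + be + n%:~R * be).

Definition intser_basis_act (i : W22_basis) (m : int) : intser al be :=
  if i is BL n then intser_coef n m *: intser_v (m + n) else 0.

Definition intser_act : W22 K -> intser al be -> intser al be :=
  bext intser_basis_act.

Lemma intser_act_linearl v : linear (intser_act ^~ v).
Proof. exact: bext_linearl. Qed.
Lemma intser_act_linearr x : linear (intser_act x).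
Proof. exact: bext_linearr. Qed.

Lemma intser_actUU i m : intser_act (W22_e K i) << m >> = intser_basis_act i m.
Proof. by rewrite W22_e.unlock; apply: bextUU. Qed.

Lemma intser_act0 v : intser_act 0 v = 0.
Proof. exact: (linear0 (lext _)). Qed.

Lemma intser_act0r x : intser_act x 0 = 0.
Proof.
by have := intser_act_linearr x (-1) 0 0; rewrite scaler0 addr0 scaleN1r addNr.
Qed.

Lemma intser_actZ a x v : intser_act x (a *: v) = a *: intser_act x v.
Proof. by rewrite -[a *: v]addr0 intser_act_linearr intser_act0r addr0. Qed.

Lemma intser_actN x v : intser_act (- x) v = - intser_act x v.
Proof. by rewrite -[- x]addr0 -scaleN1r intser_act_linearl intser_act0 scaleN1r addr0. Qed.

Lemma intser_act_LX X n m v :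
  intser_act (W22_LX X n m) v = (n - m)%:~R *: intser_act (X (n + m)) v.
Proof.
have C0 : intser_act eC v = 0.
  elim/(@malg_lind K): v => [|a u w hu hw|i]; first exact: intser_act0r.
    by rewrite intser_act_linearr hu hw scaler0 addr0.
  exact: intser_actUU.
rewrite /W22_LX intser_act_linearl -[_ *: eC]addr0 intser_act_linearl.
by rewrite C0 intser_act0 scaler0 !addr0.
Qed.

Lemma intser_act_lie (x y : W22 K) v : intser_act (lie x y) v =
  intser_act x (intser_act y v) - intser_act y (intser_act x v).
Proof.
have step (a : K) (u1 u2 v1 v2 : intser al be) :
    a *: (u1 - u2) + (v1 - v2) = (a *: u1 + v1) - (a *: u2 + v2).
  by rewrite scalerBr opprD addrACA.
elim/(@W22_ind K): x => [|a x x' hx hx'|i].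
- by rewrite [lie _ _]W22_lie0l !intser_act0 intser_act0r subr0.
- by rewrite lie_linearl !(intser_act_linearl, intser_act_linearr) hx hx' step.
elim/(@W22_ind K): y => [|a y y' hy hy'|j].
- rewrite [lie _ _]W22_lie0r !intser_act0.
  by rewrite intser_act0r subr0.
- by rewrite lie_linearr !(intser_act_linearl, intser_act_linearr) hy hy' step.
elim/(@malg_lind K): v => [|a v v' hv hv'|m].
- by rewrite !intser_act0r subr0.
- by rewrite !intser_act_linearr hv hv' step.
rewrite [lie _ _]W22_lieUU.
case: i j => [n|n|] [k|k|] /=; rewrite ?intser_actN ?intser_act_LX;
  rewrite !intser_actUU /= ?intser_actZ ?intser_act0r ?intser_actUU /=;
  rewrite ?(scaler0, oppr0, addr0, intser_act0) //.
rewrite !scalerA [m + (n + k)]addrA addrAC -scalerBl; congr (_ *: _).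
by rewrite /intser_coef !rmorphD !rmorphN /=; ring.
Qed.

HB.instance Definition _ := Lmodule_isLieModule.Build K (W22 K) (intser al be)
  intser_act_linearl intser_act_linearr intser_act_lie.

(* The span of v_{-al} when be = 0 and al is integral; otherwise zero. *)
Definition intser_line_space : subspace (intser al be) :=
  span (fun v => be = 0 /\ exists2 m : int, m%:~R = - al & v = intser_v m).

(* The span of all v_m, except v_{-al-1} when be = 1. *)
Definition intser_omit_space : subspace (intser al be) :=
  span (fun v => exists2 m : int, ~ (be = 1 /\ m%:~R = - al - 1) & v = intser_v m).

Lemma span_act (G : intser al be -> Prop) :
  (forall i y, G y -> intser_act (W22_e K i) y \in span G) ->
  forall x, {in span G, forall v, act x v \in span G}.
Proof.
move=> hG x; apply: (span_sub (S := Subspace (preim_submod (act x) (span G)))).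
move=> y Gy; rewrite inE /=; change (intser_act x y \in span G).
elim/(@W22_ind K): x => [|a x x' hx hx'|i]; last exact: hG.
  by rewrite intser_act0 rpred0.
by rewrite intser_act_linearl rpredD // rpredZ.
Qed.

Lemma intser_line_act :
  forall x, {in intser_line_space, forall v, act x v \in intser_line_space}.
Proof.
apply: span_act => -[n|n|] _ [be0 [m mE ->]]; rewrite intser_actUU;
  try exact: rpred0.
rewrite /intser_basis_act; have -> : intser_coef n m = 0.
  by rewrite /intser_coef be0 mE addNr mulr0 !addr0 oppr0.
by rewrite scale0r; apply: rpred0.
Qed.

Lemma intser_omit_act :
  forall x, {in intser_omit_space, forall v, act x v \in intser_omit_space}.
Proof.
apply: span_act => -[n|n|] _ [m hm ->]; rewrite intser_actUU;
  try exact: rpred0.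
rewrite /intser_basis_act; have [[be1 mn]|hmn] := pselect (be = 1 /\ (m + n)%:~R = - al - 1).
  have -> : intser_coef n m = - ((m + n)%:~R - (- al - 1)).
    by rewrite /intser_coef be1 rmorphD /=; ring.
  by rewrite mn subrr oppr0 scale0r; apply: rpred0.
by apply: rpredZ; apply: mem_span; exists (m + n).
Qed.

Definition intser_line := Submodule intser_line_act.
Definition intser_omit := Submodule intser_omit_act.

End Action.

(* V'_{al,be,0} *)
Definition intser' (al be : K) : lieModType (W22 K) :=
  let integral := `[< exists k : int, al = k%:~R >] in
  if integral && (be == 0) then mquot (intser_line al be) : lieModType (W22 K)
  else if integral && (be == 1) then msub (intser_omit al be) : lieModType (W22 K)
  else intser al be.

End IntermediateSeries.

Section Verma.
Context {K : fieldType}.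

Definition Lplus : subspace (W22 K) :=
  span (fun x => exists2 n : int, 0 < n & x = eL n \/ x = eW n).

Definition singular (V : lieModType (W22 K)) (u : V) : Prop :=
  [/\ u != 0, exists lam : K, act (eL 0 : W22 K) u = lam *: u &
      {in Lplus, forall x, act x u = 0}].

Variables c h hW : K.

Variant verma_rel : uea (W22 K) -> Prop :=
| verma_Ln (n : int) of 0 < n : verma_rel (uea_in (eL n))
| verma_Wn (n : int) of 0 < n : verma_rel (uea_in (eW n))
| verma_C : verma_rel (uea_in eC - c%:A)
| verma_L0 : verma_rel (uea_in (eL 0) - h%:A)
| verma_W0 : verma_rel (uea_in (eW 0) - hW%:A).

Definition verma_ideal : submodule (uea (W22 K)) :=
  leftIdeal_submodule (leftIdeal_gen verma_rel).

Definition verma : lieModType (W22 K) := mquot verma_ideal.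

Definition verma_v : verma := lpi verma_ideal 1.

(* ms = [:: m_s; ...; m_1] encodes W_{-m_s} ... W_{-m_1} v. *)
Definition verma_Wmon (ms : seq nat) : verma :=
  foldr (fun m u => act (eW (- m%:Z)) u) verma_v ms.

Definition verma_W : subspace verma :=
  span (fun y => exists2 ms : seq nat,
    sorted geq ms /\ all (leq 1) ms & y = verma_Wmon ms).

End Verma.

(* Main.v *)
From HB Require Import structures.
From mathcomp Require Import all_boot all_order all_algebra.
From mathcomp Require Import reals complex.
From mathcomp Require Import boolp functions.
From mathcomp.multinomials Require Import monalg.
Require Import Defs.

Set Implicit Arguments.
Unset Strict Implicit.
Unset Printing Implicit Defensive.

Import Order.TTheory GRing.Theory Num.Theory.
Local Open Scope ring_scope.

(** Write E for the intermediate series module, with basis vectors e_m, V for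
the Verma module with its highest weight vector v, and Q = V / J for the simple
quotient, in which v becomes y.  Let n be the span of the L_k and W_k with
k < 0.  Fix k with e_k and e_(k-1) nonzero, which leaves room for one vanishing
e_m.  The span of all x (e_m ⊗ y) with x in U(n) and m >= k is a submodule of
E ⊗ Q: the non-negative part of W(2,2) can only raise m ([upper_act],
[ract_span_act]).  It is nonzero, and the point is that it misses
e_(k-1) ⊗ y.

Suppose that e_(k-1) ⊗ y is a sum of terms x_m (e_m ⊗ y) with m >= k.
Since n lowers the index of e_m, the component along e_m of x_m (e_m ⊗ y) is
x_m y and its other components have smaller index ([ract_tens_leading]).  For
the largest m that occurs this forces x_m y = 0 in Q.  If x_m y = 0 implies
x_m (e_m ⊗ y) = 0, the top term can be discarded, and by descent
([zero_of_contract]) the whole sum is zero, which e_(k-1) ⊗ y is not.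

The required implication is [annihilator_lift].  If x y = 0 in Q then x v lies
in J, which is U(n) u' because u' is singular ([singular_submodule]).  As u'
lies in the W-subspace it is P v for a polynomial P in the W_(-k)
([verma_W_lift]), hence x v = z P v for some z in U(n).  The Verma module is
free over U(n), so x = z P; and since every W_j kills E, the polynomial P acts
on the second factor of the tensor product only, whence
x (e_m ⊗ y) = z (e_m ⊗ P y) = 0 because P y is the image of u'.

Freeness of V over U(n), [verma_free], is obtained without a
Poincare-Birkhoff-Witt basis.  The space U(n) itself is made into a module over
the whole algebra, by the rule x (a z) = a (x z) + [x, a] z for a in n, together
with the prescribed value of x 1 ([induced]).  It receives a homomorphism from V
that sends v to 1, hence x v to x.

The case distinction in the definition of V'_(alpha,beta,0) is hidden behind the
notion of a [ladder]; the vanishing e_m is the vector divided out or omitted. *)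

(** * Linear maps and quotients *)

Section LinearMaps.
Context {K : fieldType} {V W : lmodType K} (f : V -> W) (f_lin : linear f).

Lemma lin0 : f 0 = 0.
Proof. by have := f_lin (-1) 0 0; rewrite scaler0 addr0 scaleN1r addNr. Qed.

Lemma linZ a u : f (a *: u) = a *: f u.
Proof. by rewrite -[a *: u]addr0 f_lin lin0 addr0. Qed.

Lemma linD u v : f (u + v) = f u + f v.
Proof. by rewrite -[u]scale1r f_lin !scale1r. Qed.

Lemma linN u : f (- u) = - f u.
Proof. by rewrite -scaleN1r linZ scaleN1r. Qed.

Lemma linB u v : f (u - v) = f u - f v.
Proof. by rewrite linD linN. Qed.

End LinearMaps.

Section Descent.
Context {K : fieldType} {V Z : lmodType K} (S : subspace V) (f : V -> Z).

Definition descend (q : lquot S) : Z := f (lrepr q).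

Hypotheses (f_lin : linear f) (f_ker : forall v, v \in S -> f v = 0).

Lemma descendE v : descend (lpi S v) = f v.
Proof.
by apply/eqP; rewrite -subr_eq0 -(linB f_lin) ?f_ker ?lrepr_lpi.
Qed.

Lemma descend_linear : linear descend.
Proof.
move=> a p q; rewrite -[p]lreprK -[q]lreprK -(lpi_linear S) !descendE.
exact: f_lin.
Qed.

End Descent.

(** * The action of the enveloping algebra on a module *)

Section FreeAlgebra.
Context {K : fieldType} {g : lieAlgType K}.
Local Notation T := {malg K[{fmonom g}]}.

Lemma free_ind (P : T -> Prop) :
  P 0 -> (forall a p q, P p -> P q -> P (a *: p + q)) -> P 1 ->
  (forall x p, P p -> P (<< fmu x >> * p)) -> forall p, P p.
Proof.
move=> P0 PD P1 PM; apply: malg_lind => // -[w].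
elim: w => [|x w IHw].
  have -> : << FMonom [::] >> = 1 :> T; last exact: P1.
  by congr (<< _ >>); apply: val_inj; rewrite /= fm1.
have -> : << FMonom (x :: w) >> = << fmu x >> * << FMonom w >> :> T.
  by rewrite malgM_def fgmulUU mulr1; congr (<< _ >>); apply: val_inj; rewrite /= fmM fmuE.
exact: PM.
Qed.

End FreeAlgebra.

Section UniversalAction.
Context {K : fieldType} {g : lieAlgType K} {V : lieModType g}.
Local Notation T := {malg K[{fmonom g}]}.

(** Elements of U(g) are classes of such [p]; [free_uact_ideal] makes the action
descend to them. *)
Definition free_uact (v : V) (p : T) : V :=
  lext (fun w : {fmonom g} => foldr (fun x u => act x u) v w) p.

Lemma free_uact_linear v : linear (free_uact v).
Proof. exact: lext_linear. Qed.

Lemma free_uact0 v : free_uact v 0 = 0.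
Proof. exact: (linear0 (lext _)). Qed.

Lemma free_uact1 v : free_uact v 1 = v.
Proof. by rewrite /free_uact [X in lext _ X]/(1 : T) lextU fm1. Qed.

Lemma free_uactX v x p : free_uact v (<< fmu x >> * p) = act x (free_uact v p).
Proof.
elim/(@malg_lind K): p => [|a p q hp hq|w].
- by rewrite mulr0 free_uact0 linear0.
- have -> : << fmu x >> * (a *: p + q) = a *: (<< fmu x >> * p) + << fmu x >> * q.
    by rewrite malg_scaleAr -mulrDr.
  rewrite (free_uact_linear v a p q) act_linearr -hp -hq.
  exact: free_uact_linear.
by rewrite malgM_def fgmulUU mulr1 /free_uact !lextU fmM fmuE.
Qed.

Lemma free_uactM v p q : free_uact v (p * q) = free_uact (free_uact v q) p.
Proof.
elim/(@free_ind K g): p => [|a p p' hp hp'||x p hp].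
- by rewrite mul0r !free_uact0.
- have -> : (a *: p + p') * q = a *: (p * q) + p' * q.
    by rewrite (fgscaleAl a p q) -mulrDl.
  rewrite (free_uact_linear _ a p p') -hp -hp'.
  exact: free_uact_linear.
- by rewrite mul1r free_uact1.
by rewrite -mulrA !free_uactX hp.
Qed.

Lemma free_uact_linearr p : linear (free_uact ^~ p).
Proof.
move=> a u v; elim/(@free_ind K g): p => [|b p q hp hq||x p hp].
- by rewrite !free_uact0 scaler0 addr0.
- by rewrite !free_uact_linear hp hq !scalerDr !scalerA mulrC addrACA.
- by rewrite !free_uact1.
by rewrite !free_uactX hp act_linearr.
Qed.

Lemma free_uact0v p : free_uact 0 p = 0.
Proof. exact: (lin0 (free_uact_linearr p)). Qed.

(** The elements that annihilate every vector form a two-sided ideal, and the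
module axioms put the defining relations of the enveloping algebra in it. *)
Lemma free_uact_ideal v p : p \in uea_ideal g -> free_uact v p = 0.
Proof.
pose ann : {pred T} := [pred p | `[< forall v, free_uact v p = 0 >]].
have ann_sub : submod_closed ann.
  split=> [|a p' q]; rewrite !inE; first by apply/asboolP => u; apply: free_uact0.
  move=> /asboolP hp /asboolP hq; apply/asboolP => u.
  by rewrite free_uact_linear hp hq scaler0 addr0.
have annMl q : {in Subspace ann_sub, forall p, q * p \in Subspace ann_sub}.
  by move=> p' /asboolP hp; apply/asboolP => u; rewrite free_uactM hp free_uact0v.
have annMr q : {in Subspace ann_sub, forall p, p * q \in Subspace ann_sub}.
  by move=> p' /asboolP hp; apply/asboolP => u; rewrite free_uactM hp.
have uE x u : free_uact u << fmu x >> = act x u.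
  by rewrite -[<< fmu x >>]mulr1 free_uactX free_uact1.
have uB u p' q : free_uact u (p' - q) = free_uact u p' - free_uact u q.
  exact: (linearB (lext _)).
move=> /asboolP /(_ (Ideal annMl annMr)) pann.
apply: (asboolW (pann _)) => y hy; apply/asboolP => u; case: hy => [a x z|x z].
  have uBP p1 p2 p3 : free_uact u (p1 - (a *: p2 + p3)) =
    free_uact u p1 - (a *: free_uact u p2 + free_uact u p3).
    by rewrite uB free_uact_linear.
  by rewrite uBP !uE act_linearl subrr.
have uBB p1 p2 p3 : free_uact u (p1 - p2 - p3) =
    free_uact u p1 - free_uact u p2 - free_uact u p3 by rewrite (uB u (p1 - p2)) uB.
apply: (etrans (uBB _ _ _)); apply/eqP; rewrite subr_eq0 uE act_lie; apply/eqP.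
have uM a b : free_uact u (<< fmu a >> * << fmu b >>) = act a (act b u).
  by rewrite free_uactX uE.
by congr (_ - _); apply: uM.
Qed.

Definition uact (x : uea g) (v : V) : V := free_uact v (uea_repr x).

Lemma uact_pi p v : uact (uea_pi p) v = free_uact v p.
Proof.
apply: (@descendE _ _ _ (uea_ideal g) (free_uact v)).
  exact: free_uact_linear.
exact: free_uact_ideal.
Qed.

Lemma uact_linearl v : linear (uact ^~ v).
Proof.
apply: (@descend_linear _ _ _ (uea_ideal g) (free_uact v)).
  exact: free_uact_linear.
exact: free_uact_ideal.
Qed.

Lemma uact_linearr x : linear (uact x).
Proof. exact: free_uact_linearr. Qed.

HB.instance Definition _ x :=
  GRing.isLinear.Build K V V *:%R (uact x) (uact_linearr x).

Lemma uact1 v : uact 1 v = v.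
Proof. by rewrite [X in uact X]/(uea_pi 1) uact_pi free_uact1. Qed.

Lemma uact0 v : uact 0 v = 0.
Proof. by rewrite -(linear0 (lpi (uea_ideal g))) uact_pi free_uact0. Qed.

Lemma uactM x y v : uact (x * y) v = uact x (uact y v).
Proof.
by rewrite -[x]lreprK -[y]lreprK -!/(uea_pi _) -uea_piM !uact_pi free_uactM.
Qed.

Lemma uact_in x v : uact (uea_in x) v = act x v.
Proof. by rewrite uact_pi -[<< fmu x >>]mulr1 free_uactX free_uact1. Qed.

End UniversalAction.

Section UniversalActionTheory.
Context {K : fieldType} {g : lieAlgType K}.

Lemma uea_ind (P : uea g -> Prop) :
  P 0 -> (forall a x y, P x -> P y -> P (a *: x + y)) -> P 1 ->
  (forall x y, P y -> P (uea_in x * y)) -> forall x, P x.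
Proof.
move=> P0 PD P1 PM x; rewrite -[x]lreprK; move: (lrepr x).
apply: free_ind => [|a p q hp hq||y p hp].
- by rewrite linear0.
- by rewrite linearP; apply: PD.
- exact: P1.
have := uea_piM << fmu y >> p; rewrite /uea_pi => ->; exact: PM.
Qed.

Lemma uact_sub (V : lieModType g) (N : submodule V) x v :
  v \in N -> uact x v \in N.
Proof.
move=> vN; elim/uea_ind: x => [|a x y hx hy||x y hy].
- by rewrite uact0 rpred0.
- by rewrite uact_linearl rpredD ?rpredZ.
- by rewrite uact1.
by rewrite uactM uact_in submodule_act.
Qed.

Lemma uact_hom (V W : lieModType g) (f : V -> W) :
  linear f -> (forall x v, f (act x v) = act x (f v)) ->
  forall x v, f (uact x v) = uact x (f v).
Proof.
move=> f_lin f_act x v.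
have f0 := lin0 f_lin.
elim/uea_ind: x => [|a x y hx hy||x y hy].
- by rewrite !uact0.
- by rewrite !uact_linearl f_lin hx hy.
- by rewrite !uact1.
by rewrite !uactM !uact_in f_act hy.
Qed.

Lemma uact_regular (x y : uea g) : uact x y = x * y.
Proof.
elim/uea_ind: x => [|a x x' hx hx'||x x' hx].
- by rewrite uact0 mul0r.
- by rewrite uact_linearl hx hx' mulrDl scalerAl.
- by rewrite uact1 mul1r.
by rewrite uactM uact_in hx -mulrA.
Qed.

End UniversalActionTheory.

(** * Lie subalgebras and restriction *)

Section LieSubalgebra.
Context {K : fieldType} {L : lieAlgType K}.

Record lieSubalg := LieSubalg {
  lieSubalg_space :> subspace L;
  lieSubalg_lie : forall x y, x \in lieSubalg_space -> y \in lieSubalg_space ->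
    lie x y \in lieSubalg_space
}.

Variable n : lieSubalg.

Definition lsub : Type := {x : L | x \in n}.
HB.instance Definition _ := Choice.on lsub.
HB.instance Definition _ := SubType.on lsub.
HB.instance Definition _ :=
  @GRing.SubChoice_isSubLmodule.Build K L (mem n) lsub
    (GRing.submod_closed_semi (subspaceP n)).

Definition lsub_lie (x y : lsub) : lsub :=
  exist _ (lie (val x) (val y)) (lieSubalg_lie (valP x) (valP y)).

Lemma lsub_lie_linearl y : linear (lsub_lie ^~ y).
Proof. by move=> a x x'; apply: val_inj; rewrite linearP /= lie_linearl. Qed.
Lemma lsub_lie_linearr x : linear (lsub_lie x).
Proof. move=> a y y'; apply: val_inj; rewrite [RHS]linearP /=. exact: lie_linearr. Qed.
Lemma lsub_liexx x : lsub_lie x x = 0.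
Proof. by apply: val_inj; rewrite linear0 /= liexx. Qed.
Lemma lsub_jacobi x y z : lsub_lie x (lsub_lie y z) +
  lsub_lie y (lsub_lie z x) + lsub_lie z (lsub_lie x y) = 0.
Proof. by apply: val_inj; rewrite !linearD linear0 /= lie_jacobi. Qed.

HB.instance Definition _ := Lmodule_isLieAlgebra.Build K lsub
  lsub_lie_linearl lsub_lie_linearr lsub_liexx lsub_jacobi.

Lemma val_lie (x y : lsub) : val (lie x y) = lie (val x) (val y).
Proof. by []. Qed.

Definition restrict (V : lieModType L) : Type := V.

Section Restriction.
Variable V : lieModType L.
HB.instance Definition _ := GRing.Lmodule.on (restrict V).

Definition restrict_act (x : lsub) (v : restrict V) : restrict V :=
  act (val x) (v : V).

Lemma restrict_act_linearl v : linear (restrict_act ^~ v).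
Proof. by move=> a x y; rewrite /restrict_act linearP act_linearl. Qed.
Lemma restrict_act_linearr x : linear (restrict_act x).
Proof. by move=> a u v; rewrite /restrict_act act_linearr. Qed.
Lemma restrict_act_lie x y v : restrict_act (lie x y) v =
  restrict_act x (restrict_act y v) - restrict_act y (restrict_act x v).
Proof. exact: act_lie. Qed.

HB.instance Definition _ := Lmodule_isLieModule.Build K lsub (restrict V)
  restrict_act_linearl restrict_act_linearr restrict_act_lie.

(** The action of the enveloping algebra of a subalgebra on a module of the whole
algebra, typed so that the result is again in [V]. *)
Definition ract (x : uea lsub) (v : V) : V := uact x (v : restrict V).

End Restriction.
End LieSubalgebra.

Section LieTheory.
Context {K : fieldType} {L : lieAlgType K}.

Lemma lieC (x y : L) : lie y x = - lie x y.
Proof.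
apply/eqP; rewrite -addr_eq0; apply/eqP.
by have := liexx (x + y); rewrite (linD (lie_linearl _)) !(linD (lie_linearr _)) !liexx add0r addr0 addrC.
Qed.

(** The Jacobi identity as the statement that [lie ^~ y] and [lie ^~ x] have
commutator [lie ^~ (lie x y)] up to sign; it is what makes [homs] a module. *)
Lemma lie_lie (x y z : L) : lie z (lie x y) = lie (lie z x) y - lie (lie z y) x.
Proof.
rewrite (lieC y (lie z x)) (lieC x (lie z y)) (lieC y z) opprK.
rewrite -[- lie y z]scaleN1r (linZ (lie_linearr _)) scaleN1r.
by apply/eqP; rewrite -subr_eq0 opprB opprK addrC lie_jacobi.
Qed.

End LieTheory.

(** * Linear maps from the whole algebra into a module of a subalgebra *)

Section HomModule.
Context {K : fieldType} {L : lieAlgType K} (n : @lieSubalg K L).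
Variable Y : lieModType (lsub n).

Lemma linfun_submod :
  submod_closed [pred f : L -> Y | `[< linear f >] ].
Proof.
split=> [|a f g]; rewrite !inE.
  by apply/asboolP => b x y; rewrite scaler0 addr0.
move=> /asboolP hf /asboolP hg; apply/asboolP => b x y /=.
rewrite !fctE hf hg !scalerDr !scalerA (mulrC a b) -!addrA; congr (_ + _).
by rewrite addrCA.
Qed.

Definition linfun_space : subspace (L -> Y) := Subspace linfun_submod.

(** Hom(L, Y) with the natural action of the subalgebra,
(a f)(x) = a f(x) - f [a, x].  The action of L on an induced module is read off
from the U(n)-orbit of one element of Hom(L, U(n)), which spares a separate
proof that this action respects the relations of U(n). *)
Definition homs : Type := {f : L -> Y | f \in linfun_space}.
HB.instance Definition _ := Choice.on homs.
HB.instance Definition _ := SubType.on homs.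
HB.instance Definition _ :=
  @GRing.SubChoice_isSubLmodule.Build K (L -> Y) (mem linfun_space) homs
    (GRing.submod_closed_semi (subspaceP linfun_space)).

Lemma homs_linear (f : homs) : linear (sval f).
Proof. by apply/asboolP; apply: (valP f). Qed.

Lemma homsB (f : homs) x y : sval f (x - y) = sval f x - sval f y.
Proof. exact: linB (homs_linear f) x y. Qed.

Lemma homs_lincomb a (f g : homs) x :
  sval (a *: f + g) x = a *: sval f x + sval g x.
Proof.
have /(congr1 (fun h : L -> Y => h x)) := linearP (\val : homs -> (L -> Y)) a f g.
by [].
Qed.

Lemma homs_act_subproof (a : lsub n) (f : homs) :
  (fun x => act a (sval f x) + sval f (lie x (val a))) \in linfun_space.
Proof.
apply/asboolP => b x y; rewrite lie_linearl !homs_linear act_linearr.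
by rewrite scalerDr addrACA.
Qed.

Definition homs_act a f : homs :=
  exist (fun h : L -> Y => h \in linfun_space) _ (homs_act_subproof a f).

Lemma homs_act_linearl f : linear (homs_act ^~ f).
Proof.
move=> a x y; apply: val_inj; apply/funext => z.
rewrite linearP /= !fctE act_linearl lie_linearr homs_linear.
by rewrite scalerDr addrACA.
Qed.

Lemma homs_act_linearr x : linear (homs_act x).
Proof.
move=> a f g; apply: val_inj; apply/funext => z.
by rewrite [in RHS]linearP /= linearP !fctE scalerDr addrACA.
Qed.

Lemma homs_act_lie x y f :
  homs_act (lie x y) f = homs_act x (homs_act y f) - homs_act y (homs_act x f).
Proof.
apply: val_inj; apply/funext => z.
rewrite linearB /= !fctE act_lie !linearD /= lie_lie homsB.
by rewrite -!opprD; apply: tensor_zmod.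
Qed.

HB.instance Definition _ := Lmodule_isLieModule.Build K (lsub n) homs
  homs_act_linearl homs_act_linearr homs_act_lie.

End HomModule.

(** * The enveloping algebra of a subalgebra as an induced module *)

Section Induced.
Context {K : fieldType} {L : lieAlgType K}.

(** A decomposition of [L] as the sum of [n] and a complementary subalgebra, the
kernel of [sproj], together with a character of that kernel, extended by zero to
[n]. *)
Record splitting (n : @lieSubalg K L) := Splitting {
  sproj : L -> lsub n;
  sproj_linear : linear sproj;
  sproj_val : forall a, sproj (val a) = a;
  schar : L -> K;
  schar_linear : linear (schar : L -> K^o);
  schar_val : forall a : lsub n, schar (val a) = 0;
  sproj_ker : forall x y, sproj x = 0 -> sproj y = 0 -> sproj (lie x y) = 0;
  schar_ker : forall x y, sproj x = 0 -> sproj y = 0 -> schar (lie x y) = 0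
}.

(** The module induced to [L] from the one-dimensional module of the
complementary subalgebra on which it acts through the character. *)
Definition induced (n : @lieSubalg K L) (d : splitting n) : Type := uea (lsub n).
HB.instance Definition _ n (d : splitting n) := GRing.Lmodule.on (induced d).

Context {n : @lieSubalg K L} (d : splitting n).
Local Notation U := (uea (lsub n)).

(** The map that sends x to the prescribed value of x 1, the component of x in [n]
plus its character; it generates the action in [ind_act]. *)
Lemma ind_seed_subproof :
  (fun x => uea_in (sproj d x) + (schar d x)%:A : U) \in linfun_space U.
Proof.
apply/asboolP => a x y; rewrite sproj_linear uea_in_linear.
have -> : schar d (a *: x + y) = a * schar d x + schar d y := schar_linear d a x y.
by rewrite scalerDl -scalerA scalerDr addrACA.
Qed.

Definition ind_seed : homs U :=
  exist (fun h : L -> U => h \in linfun_space U) _ ind_seed_subproof.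

(** As [y] runs through products a z with a in [n], the action of U(n) on Hom(L,
U(n)) unfolds to the commutation rule [ind_actX], which determines everything
from the values on 1. *)
Definition ind_act (x : L) (y : induced d) : induced d := sval (uact y ind_seed) x.

Lemma ind_act_linearl y : linear (ind_act ^~ y).
Proof. exact: homs_linear. Qed.

Lemma ind_act_linearr x : linear (ind_act x).
Proof.
by move=> a y z; rewrite /ind_act uact_linearl homs_lincomb.
Qed.

Definition ind_one : induced d := (1 : U).

Lemma ind_act1 x : ind_act x ind_one = uea_in (sproj d x) + (schar d x)%:A :> U.
Proof. by rewrite /ind_act uact1. Qed.

Lemma ind_actX x (a : lsub n) (y : U) : ind_act x (uea_in a * y) =
  uea_in a * (ind_act x y : U) + ind_act (lie x (val a)) y :> U.
Proof. by rewrite /ind_act uactM uact_in. Qed.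

Lemma ind_act_in x (a : lsub n) : ind_act x (uea_in a) =
  uea_in a * uea_in (sproj d x) + schar d x *: uea_in a +
  (uea_in (sproj d (lie x (val a))) + (schar d (lie x (val a)))%:A) :> U.
Proof.
by rewrite -{1}[uea_in a]mulr1 ind_actX !ind_act1 mulrDr -scalerAr mulr1.
Qed.

(** Expand the bracket of the components of [x] and [y] in the complementary
subalgebra: projection and character both vanish on it. *)
Lemma splitting_lie x y :
  sproj d (lie x y) = sproj d (lie x (val (sproj d y))) -
    sproj d (lie y (val (sproj d x))) - lie (sproj d x) (sproj d y) /\
  schar d (lie x y) = schar d (lie x (val (sproj d y))) -
    schar d (lie y (val (sproj d x))).
Proof.
set a := sproj d x; set b := sproj d y.
have pB := linB (@sproj_linear n d).
have cB : {morph schar d : u v / u - v} := linB (@schar_linear n d).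
have px : sproj d (x - val a) = 0 by rewrite pB sproj_val subrr.
have py : sproj d (y - val b) = 0 by rewrite pB sproj_val subrr.
have lE : lie (x - val a) (y - val b) =
    lie x y - (lie x (val b) - lie y (val a) - lie (val a) (val b)).
  rewrite (linB (lie_linearl _)) !(linB (lie_linearr _)).
  rewrite (lieC y (val a)) !opprB opprK -addrA; congr (_ + _).
  by rewrite addrC -addrA.
have := schar_ker px py; have := sproj_ker px py.
rewrite lE !pB !cB -val_lie sproj_val schar_val subr0.
by move=> /eqP; rewrite subr_eq0 => /eqP -> /eqP; rewrite subr_eq0 => /eqP ->.
Qed.

(** Induction on [z].  For z = 1 both sides are computed and compared by
[splitting_lie]; to pass from z to a z, commute with a and use the Jacobi
identity. *)
Lemma ind_act_lie x y z :
  ind_act (lie x y) z = ind_act x (ind_act y z) - ind_act y (ind_act x z).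
Proof.
elim/(@uea_ind K): z x y => [|a z z' hz hz'||a z hz] x y.
- by rewrite !(lin0 (ind_act_linearr _)) subr0.
- by rewrite !ind_act_linearr hz hz' scalerBr opprD addrACA.
- have actD u v c : ind_act u (uea_in v + c%:A) =
      ind_act u (uea_in v) + c *: ind_act u (1 : U).
    by rewrite (linD (ind_act_linearr _)) (linZ (ind_act_linearr _)).
  (* s, t and u are the terms symmetric in x and y; they cancel. *)
  have cancel_cross (Z : zmodType) (A B C D s t u : Z) :
      A + s + B + (t + u) - (C + t + D + (s + u)) = (A - C) + (B - D).
    rewrite (addrAC A) -(addrA (A + B)) (addrAC C) -(addrA (C + D)).
    by rewrite (addrCA t) opprD addrACA subrr addr0 opprD addrACA.
  have [pE cE] := splitting_lie x y.
  rewrite !ind_act1 !actD !ind_act_in !ind_act1 !scalerDr.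
  rewrite (scalerA (schar d y)) (scalerA (schar d x)) (mulrC (schar d y)).
  rewrite cancel_cross pE cE !(linB (@uea_in_linear K (lsub n))) uea_in_lie scalerBl opprB.
  by rewrite opprD [in RHS](addrACA (uea_in _)) [RHS]addrA; congr (_ + _); rewrite addrC.
rewrite !ind_actX !(linD (ind_act_linearr _)) !ind_actX.
have -> : lie (lie x y) (val a) = lie (lie x (val a)) y + lie x (lie y (val a)).
  by rewrite (lie_lie y) addrC subrK.
have regroup (Z : zmodType) (A B C D E F : Z) :
    A - B + (C - D + (E - F)) = A + C + E - (B + F + D).
  by rewrite -(addrA A C) -(addrA B F) opprD [RHS]addrACA (addrC F) opprD
    [in RHS](addrACA C).
by rewrite (linD (ind_act_linearl _)) !hz mulrBr regroup.
Qed.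

HB.instance Definition _ := Lmodule_isLieModule.Build K L (induced d)
  ind_act_linearl ind_act_linearr ind_act_lie.

End Induced.

(** * Submodules generated over a subalgebra *)

Section Generation.
Context {K : fieldType}.

Lemma span_ind (V : lmodType K) (G P : V -> Prop) :
  P 0 -> (forall a x y, P x -> P y -> P (a *: x + y)) ->
  (forall y, G y -> P y) -> forall x, x \in span G -> P x.
Proof.
move=> P0 PD PG x.
have PS : submod_closed [pred y | `[< P y >]].
  split=> [|a u v]; rewrite !inE; first by apply/asboolP.
  by move=> /asboolP Pu /asboolP Pv; apply/asboolP; apply: PD.
by move=> /(span_sub (S := Subspace PS)) h; apply/asboolP/h => y /PG /asboolP.
Qed.

Context {L : lieAlgType K} {n : @lieSubalg K L} {V : lieModType L}.

Lemma ract_linearl (v : V) : linear ((@ract K L n V) ^~ v).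
Proof. exact: (@uact_linearl K _ (restrict V)). Qed.

Lemma ract_linearr (x : uea (lsub n)) : linear (@ract K L n V x).
Proof. exact: (@uact_linearr K _ (restrict V)). Qed.

Lemma ract0 (v : V) : ract (0 : uea (lsub n)) v = 0.
Proof. exact: (@uact0 K _ (restrict V)). Qed.

Lemma ract1 (v : V) : ract (1 : uea (lsub n)) v = v.
Proof. exact: (@uact1 K _ (restrict V)). Qed.

Lemma ractM (x y : uea (lsub n)) (v : V) : ract (x * y) v = ract x (ract y v).
Proof. exact: (@uactM K _ (restrict V)). Qed.

Lemma ract_in (a : lsub n) (v : V) : ract (uea_in a) v = act (val a) v.
Proof. exact: (@uact_in K _ (restrict V)). Qed.

Definition ract_span (G : V -> Prop) : subspace V :=
  span (fun y => exists (x : uea (lsub n)) g, G g /\ y = ract x g).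

(** U(n) G is stable under all of [L] as soon as [L] maps G into it: an element of
[L] can be moved to the right past elements of [n], at the price of commutators
which are again in [L]. *)
Lemma ract_span_act (G : V -> Prop) :
  (forall z g, G g -> act z g \in ract_span G) ->
  forall z, {in ract_span G, forall v, act z v \in ract_span G}.
Proof.
move=> hG.
have nG (a : lsub n) v : v \in ract_span G -> act (val a) v \in ract_span G.
  move: v; apply: span_ind => [|b u v hu hv|_ [x [g [Gg ->]]]].
  - by rewrite linear0 rpred0.
  - by rewrite linearP rpredD ?rpredZ.
  apply: mem_span; exists (uea_in a * x), g; split=> //.
  by rewrite ractM ract_in.
move=> z; apply: span_ind => [|b u v hu hv|_ [x [g [Gg ->]]]].
- by rewrite linear0 rpred0.
- by rewrite linearP rpredD ?rpredZ.
elim/(@uea_ind K): x z => [|b x y hx hy||a x hx] z.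
- by rewrite ract0 linear0 rpred0.
- by rewrite ract_linearl act_linearr rpredD ?rpredZ ?hx ?hy.
- by rewrite ract1; apply: hG.
rewrite ractM ract_in -[act z _](subrK (act (val a) (act z (ract x g)))).
by rewrite -act_lie rpredD ?hx ?nG.
Qed.

Definition ract_gen G hG : submodule V := Submodule (@ract_span_act G hG).

End Generation.

Lemma ract_hom (K : fieldType) (L : lieAlgType K) (n : @lieSubalg K L)
    (V W : lieModType L) (f : V -> W) :
  linear f -> (forall x v, f (act x v) = act x (f v)) ->
  forall (x : uea (lsub n)) v, f (ract x v) = ract x (f v).
Proof.
move=> f_lin f_act x v.
elim/(@uea_ind K): x => [|a x y hx hy||y x hx].
- by rewrite !ract0 (lin0 f_lin).
- by rewrite !ract_linearl f_lin hx hy.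
- by rewrite !ract1.
by rewrite !ractM !ract_in f_act hx.
Qed.

Lemma uact_leftIdeal (K : fieldType) (g : lieAlgType K) (V : lieModType g)
    (G : uea g -> Prop) (v : V) :
  (forall p, G p -> uact p v = 0) ->
  forall p, p \in leftIdeal_gen G -> uact p v = 0.
Proof.
move=> hG p.
have ann : submod_closed [pred p : uea g | uact p v == 0].
  split=> [|a x y]; rewrite !inE ?uact0 // => /eqP hx /eqP hy.
  by rewrite uact_linearl hx hy scaler0 addr0.
have annM a : {in Subspace ann, forall x, a * x \in Subspace ann}.
  by move=> x /eqP hx; apply/eqP; rewrite uactM hx linear0.
by move=> /asboolP /(_ (LeftIdeal annM)) h; apply/eqP/h => y /hG/eqP.
Qed.

(** * The negative part of W(2,2) *)

Section NegativePart.
Context {K : fieldType}.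
Local Notation W22 := (W22 K).

Definition negative (i : W22_basis) : bool :=
  match i with BL n | BW n => n < 0 | BC => false end.

Definition Lminus_space : subspace W22 :=
  span (fun x => exists2 i, negative i & x = W22_e K i).

(** The central term requires m = - n; when n and m lie on the same side this
forces n = 0, and then its coefficient n^3 - n is zero. *)
Lemma W22_LX_same (X : int -> W22) n m : (n < 0) = (m < 0) ->
  W22_LX X n m = (n - m)%:~R *: X (n + m).
Proof.
move=> nm; rewrite /W22_LX; case: eqP => [nE|_]; last by rewrite scale0r addr0.
suff -> : n = 0 by rewrite expr0n subrr mul0r scale0r addr0.
by apply/eqP; move: nm; rewrite nE oppr_lt0 oppr_eq0; case: ltgtP.
Qed.

Lemma negative_lie i j : negative i -> negative j ->
  (W22_brac i j : W22) \in Lminus_space.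
Proof.
have mem k : negative k -> W22_e K k \in Lminus_space.
  by move=> hk; apply: mem_span; exists k.
have LXin b n m : (b = BL \/ b = BW) -> n < 0 -> m < 0 ->
    W22_LX (fun k => W22_e K (b k)) n m \in Lminus_space.
  move=> hb hn hm; rewrite W22_LX_same ?hn ?hm // rpredZ // mem //.
  by case: hb => ->; rewrite /= -oppr_gt0 opprD addr_gt0 ?oppr_gt0.
case: i j => [n|n|] [m|m|] hn hm //.
- exact: (LXin BL _ _ (or_introl erefl)).
- exact: (LXin BW _ _ (or_intror erefl)).
- by rewrite rpredN; apply: (LXin BW _ _ (or_intror erefl)).
- exact: rpred0.
Qed.

Lemma Lminus_lie (x y : W22) :
  x \in Lminus_space -> y \in Lminus_space -> lie x y \in Lminus_space.
Proof.
move=> hx hy; move: x hx; apply: span_ind => [|a u v hu hv|_ [i hi ->]].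
- by rewrite (lin0 (lie_linearl _)) rpred0.
- by rewrite lie_linearl rpredD ?rpredZ.
move: y hy; apply: span_ind => [|a u v hu hv|_ [j hj ->]].
- by rewrite (lin0 (lie_linearr _)) rpred0.
- by rewrite lie_linearr rpredD ?rpredZ.
by rewrite [lie _ _]W22_lieUU negative_lie.
Qed.

Definition Lminus : lieSubalg := LieSubalg Lminus_lie.
Local Notation n := (lsub Lminus).

Lemma mem_Lminus i : negative i -> W22_e K i \in Lminus.
Proof. by move=> hi; apply: mem_span; exists i. Qed.

Definition neg_elt i (hi : negative i) : n :=
  exist (fun x => x \in Lminus) _ (mem_Lminus hi).

Lemma lextW22 (V : lmodType K) (f : W22_basis -> V) i : lext f (W22_e K i) = f i.
Proof. by rewrite W22_e.unlock lextU. Qed.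

Definition neg_part : W22 -> n :=
  lext (fun i => if negative i then insubd 0 (W22_e K i) else 0).

Lemma neg_part_linear : linear neg_part.
Proof. exact: lext_linear. Qed.

Lemma neg_partU i : val (neg_part (W22_e K i)) = if negative i then W22_e K i else 0.
Proof.
rewrite /neg_part lextW22.
by case: ifP => // hi; rewrite insubdK // mem_Lminus.
Qed.

Lemma neg_partK (a : n) : neg_part (val a) = a.
Proof.
apply: val_inj; move: (val a) (valP a); apply: span_ind => [|b u v hu hv|_ [i hi ->]].
- by rewrite (lin0 neg_part_linear).
- by rewrite neg_part_linear [LHS]linearP /= hu hv.
by rewrite neg_partU hi.
Qed.

Definition Lgeq0 : subspace W22 :=
  span (fun x => exists2 i, ~~ negative i & x = W22_e K i).

Lemma neg_part_ker x : neg_part x = 0 -> x \in Lgeq0.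
Proof.
suff h : x - val (neg_part x) \in Lgeq0 by move=> x0; rewrite x0 subr0 in h.
elim/(@W22_ind K): x => [|a x y hx hy|i].
- by rewrite (lin0 neg_part_linear) subr0 rpred0.
- rewrite neg_part_linear [X in _ - X]linearP opprD addrACA -scalerBr.
  by rewrite rpredD ?rpredZ.
rewrite neg_partU; case: ifPn => hi; first by rewrite subrr rpred0.
by rewrite subr0; apply: mem_span; exists i.
Qed.

Variables c h hW : K.

Definition weight_char (x : W22) : K :=
  lext (fun i => match i with
    | BL n => if n == 0 then h else 0
    | BW n => if n == 0 then hW else 0
    | BC => c
    end : K^o) x.

Lemma weight_char_linear : linear (weight_char : W22 -> K^o).
Proof. exact: lext_linear. Qed.

Lemma weight_charU i : weight_char (W22_e K i) = match i with
    | BL n => if n == 0 then h else 0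
    | BW n => if n == 0 then hW else 0
    | BC => c
    end.
Proof. by rewrite /weight_char lextW22. Qed.

Lemma weight_char_val (a : n) : weight_char (val a) = 0.
Proof.
move: (val a) (valP a); apply: span_ind => [|b u v hu hv|_ [i hi ->]].
- exact: (lin0 weight_char_linear).
- by rewrite weight_char_linear hu hv scaler0 addr0.
by rewrite weight_charU; case: i hi => [m|m|] //=; case: eqP => // ->.
Qed.

(** A bracket of two elements of the non-negative part involves neither the
central element nor, because of the factor n - m, L_0 or W_0.  This serves both
for the projection to the negative part and for the character. *)
Lemma geq0_lie (Z : lmodType K) (f : W22 -> Z) : linear f ->
  (forall i, ~~ negative i ->
    (forall X, (X = BL \/ X = BW) -> i <> X 0) -> i <> BC -> f (W22_e K i) = 0) ->
  forall x y, x \in Lgeq0 -> y \in Lgeq0 -> f (lie x y) = 0.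
Proof.
move=> f_lin f0.
have fLX b n m : 0 <= n -> 0 <= m -> (b = BL \/ b = BW) ->
    f (W22_LX (fun k => W22_e K (b k)) n m) = 0.
  move=> n0 m0 hb; rewrite W22_LX_same ?ltNge ?n0 ?m0 // (linZ f_lin).
  have [->|nm] := eqVneq n m; first by rewrite subrr scale0r.
  rewrite f0 ?scaler0 //.
  - by case: hb => -> /=; rewrite -leNgt addr_ge0.
  - move=> X hX; have : n + m != 0 by rewrite paddr_eq0 //; apply: contra nm => /andP[/eqP-> /eqP->].
    by move=> nm0; case: hb hX => -> [->|->] // [/eqP]; rewrite (negPf nm0).
  by case: hb => ->.
move=> x y hx hy; move: x hx; apply: span_ind => [|a u v hu hv|_ [i hi ->]].
- by rewrite (lin0 (lie_linearl _)) (lin0 f_lin).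
- by rewrite lie_linearl f_lin hu hv scaler0 addr0.
move: y hy; apply: span_ind => [|a u v hu hv|_ [j hj ->]].
- by rewrite (lin0 (lie_linearr _)) (lin0 f_lin).
- by rewrite lie_linearr f_lin hu hv scaler0 addr0.
rewrite [lie _ _]W22_lieUU.
have fN := linN f_lin.
case: i j hi hj => [p|p|] [q|q|] //=; rewrite -?leNgt => hp hq;
  rewrite ?(lin0 f_lin) // ?fN.
- by apply: (fLX BL) => //; left.
- by apply: (fLX BW) => //; right.
- by rewrite (fLX BW) ?oppr0 //; right.
Qed.

Lemma neg_part_lie x y :
  neg_part x = 0 -> neg_part y = 0 -> neg_part (lie x y) = 0.
Proof.
move=> /neg_part_ker hx /neg_part_ker hy.
apply: geq0_lie hx hy => [|i hi _ _]; first exact: neg_part_linear.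
by apply: val_inj; rewrite neg_partU (negPf hi).
Qed.

Lemma weight_char_lie x y :
  neg_part x = 0 -> neg_part y = 0 -> weight_char (lie x y) = 0.
Proof.
move=> /neg_part_ker hx /neg_part_ker hy.
apply: (geq0_lie (Z := K^o)) hx hy => [|i hi hX hC]; first exact: weight_char_linear.
rewrite weight_charU; case: i hi hX hC => [m|m|] // _ hX _; case: eqP => // m0.
- by case: (hX BL); [left | rewrite m0].
- by case: (hX BW); [right | rewrite m0].
Qed.

Definition W22_splitting : splitting Lminus :=
  Splitting neg_part_linear neg_partK weight_char_linear weight_char_val
    neg_part_lie weight_char_lie.

End NegativePart.

(** * Freeness of the Verma module over the negative part *)

Section QuotientMap.
Context {K : fieldType} {L : lieAlgType K} {V : lieModType L} (N : submodule V).

(** The projection [lpi] with the quotient module as its codomain, so that the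
action is found on its values. *)
Definition mpi (v : V) : mquot N := lpi N v.

Lemma mpi_linear : linear mpi.
Proof. exact: lpi_linear. Qed.

Lemma mpi_eq0 v : (mpi v == 0) = (v \in N).
Proof. exact: lpi_eq0. Qed.

Lemma mpi_act x v : mpi (act x v) = act x (mpi v).
Proof. by symmetry; apply: mquot_actE. Qed.

End QuotientMap.

Section Verma.
Context {K : fieldType} (c h hW : K).
Local Notation W22 := (W22 K).
Local Notation V := (verma c h hW).
Local Notation v := (verma_v c h hW).
Local Notation n := (lsub (@Lminus K)).
Local Notation M := (induced (W22_splitting c h hW)).
Local Notation one := (ind_one (W22_splitting c h hW)).

Lemma uact_verma_v (p : uea W22) : uact p v = lpi (verma_ideal c h hW) p.
Proof.
rewrite -[p in RHS]mulr1 -uact_regular; symmetry.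
apply: (@uact_hom K W22 (uea W22) V (lpi (verma_ideal c h hW))).
  exact: lpi_linear.
by move=> x q; symmetry; apply: (@mquot_actE K W22 (uea W22) (verma_ideal c h hW)).
Qed.

Lemma verma_rel_v p : verma_rel c h hW p -> uact p v = 0.
Proof.
by move=> hp; rewrite uact_verma_v; apply/eqP; rewrite lpi_eq0; apply: mem_leftIdeal_gen.
Qed.

Lemma verma_v_pos m : 0 < m -> act (eL m : W22) v = 0 /\ act (eW m : W22) v = 0.
Proof.
move=> hm; split; apply: etrans (esym (uact_in _ _)) (verma_rel_v _).
  exact: verma_Ln.
exact: verma_Wn.
Qed.

Lemma uact_eigen (U : lieModType W22) (x : W22) b (u : U) :
  uact (uea_in x - b%:A) u = 0 <-> act x u = b *: u.
Proof.
rewrite (linB (uact_linearl u)) (linZ (uact_linearl u)) uact1 uact_in.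
by split=> [/eqP|->]; rewrite ?subrr // subr_eq0 => /eqP.
Qed.

Lemma verma_v_zero : [/\ act (eL 0 : W22) v = h *: v, act (eW 0 : W22) v = hW *: v &
  act (eC : W22) v = c *: v].
Proof. by split; apply/uact_eigen; apply: verma_rel_v; constructor. Qed.

Lemma verma_v_eigen i : ~~ negative i ->
  act (W22_e K i) v = weight_char c h hW (W22_e K i) *: v.
Proof.
have [L0 W0 C0] := verma_v_zero.
rewrite weight_charU; case: i => [m|m|] //=; rewrite -leNgt le_eqVlt.
  by case/orP=> [/eqP<-|m0] //; rewrite gt_eqF // scale0r (verma_v_pos m0).1.
by case/orP=> [/eqP<-|m0] //; rewrite gt_eqF // scale0r (verma_v_pos m0).2.
Qed.

Lemma verma_sub (N : submodule V) : v \in N -> forall q, q \in N.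
Proof. by move=> vN q; rewrite -[q]lreprK -uact_verma_v uact_sub. Qed.

(** The homomorphism of W(2,2)-modules from the Verma module to the induced module
that sends the highest weight vector to 1. *)
Definition verma_to_induced : V -> M := descend (fun p : uea W22 => uact p one).

Lemma induced_act1 i : act (W22_e K i) one =
  uea_in (neg_part (W22_e K i)) + (weight_char c h hW (W22_e K i))%:A :> uea n.
Proof. exact: ind_act1. Qed.

Lemma verma_rel_induced p : verma_rel c h hW p -> uact p one = 0.
Proof.
have pos (i : W22_basis) : ~~ negative i ->
    uact (uea_in (W22_e K i)) one =
    (weight_char c h hW (W22_e K i))%:A :> uea n.
  move=> hi; rewrite uact_in induced_act1.
  have -> : neg_part (W22_e K i) = 0 by apply: val_inj; rewrite neg_partU (negPf hi).
  by rewrite (lin0 (@uea_in_linear K n)) add0r.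
have rel (i : W22_basis) b : ~~ negative i -> weight_char c h hW (W22_e K i) = b ->
    uact (uea_in (W22_e K i) - b%:A) one = 0.
  by move=> hi hb; apply/uact_eigen; rewrite -uact_in pos // hb.
case=> [m hm|m hm|||].
- by rewrite pos -?leNgt ?ltW // weight_charU gt_eqF // scale0r.
- by rewrite pos -?leNgt ?ltW // weight_charU gt_eqF // scale0r.
- by apply: rel; rewrite // weight_charU.
- by apply: rel; rewrite // weight_charU.
- by apply: rel; rewrite // weight_charU.
Qed.

Lemma verma_to_inducedE p : verma_to_induced (lpi (verma_ideal c h hW) p) = uact p one.
Proof.
apply: descendE; first exact: uact_linearl.
exact/uact_leftIdeal/verma_rel_induced.
Qed.

Lemma verma_to_induced_linear : linear verma_to_induced.
Proof.
apply: descend_linear; first exact: uact_linearl.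
exact/uact_leftIdeal/verma_rel_induced.
Qed.

Lemma verma_to_induced_act x q :
  verma_to_induced (act x q) = act x (verma_to_induced q).
Proof.
rewrite -[q]lreprK [act x _](@mquot_actE K W22 (uea W22) (verma_ideal c h hW)).
rewrite !verma_to_inducedE -[RHS]uact_in -[RHS]uactM.
by [].
Qed.

Lemma induced_act_val (a : n) (y : uea n) :
  act (val a) (y : induced (W22_splitting c h hW)) = uea_in a * y :> uea n.
Proof.
elim/(@uea_ind K): y a => [|b x y hx hy||b y hy] a.
- by rewrite mulr0; apply: (lin0 (act_linearr (s := M) _)).
- rewrite mulrDr -scalerAr -hx -hy; exact: (act_linearr (s := M)).
- rewrite [LHS]ind_act1 [sproj _ _]sproj_val [schar _ _]schar_val.
  by rewrite scale0r addr0 mulr1.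
rewrite [LHS]ind_actX [ind_act _ _]hy -val_lie [ind_act _ _]hy.
by rewrite uea_in_lie mulrBl !mulrA addrCA subrr addr0.
Qed.

(** The homomorphism to the induced module sends x v to x. *)
Lemma verma_free (x : uea n) : ract x v = 0 -> x = 0.
Proof.
move=> xv; have hom : verma_to_induced (ract x v) = uact x (verma_to_induced v) :> uea n.
  apply: (@uact_hom K n (restrict V) (uea n) verma_to_induced).
    exact: verma_to_induced_linear.
  by move=> a q; rewrite [LHS]verma_to_induced_act [LHS]induced_act_val.
have v1 : verma_to_induced v = 1 :> uea n.
  by rewrite [LHS]verma_to_inducedE uact1.
by rewrite -[x]mulr1 -uact_regular -v1 -hom xv (lin0 verma_to_induced_linear).
Qed.

End Verma.

(** * Vectors in the W-subspace *)

Section WPolynomials.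
Context {K : fieldType}.
Local Notation W22 := (W22 K).
Local Notation n := (lsub (@Lminus K)).

(** The property of polynomials in the W_k that matters here: on a tensor product
they act through the second factor when every W_k kills the first. *)
Definition Wpoly (P : uea n) : Prop :=
  forall (E V : lieModType W22) (e : E) (y : V),
    (forall m, act (eW m : W22) e = 0) ->
    ract P (tens e y : tensor E V) = tens e (ract P y).

Variables c h hW : K.
Local Notation v := (verma_v c h hW).

Lemma verma_W_lift y : y \in verma_W c h hW ->
  exists2 P : uea n, Wpoly P & y = ract P v.
Proof.
move: y; apply: span_ind => [|a x y [P hP ->] [Q hQ ->]|_ [ms [_ hms] ->]].
- exists 0; last by rewrite ract0.
  by move=> E V e y he; rewrite !ract0 (lin0 (tens_linearr _)).
- exists (a *: P + Q); last by rewrite ract_linearl.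
  by move=> E V e z he; rewrite !ract_linearl hP // hQ // tens_linearr.
elim: ms hms => [_|m ms IH /= /andP[m1 /IH[P hP ->]]].
  by exists 1; [move=> E V e y he; rewrite !ract1 | rewrite ract1].
have hm : negative (BW (- m%:Z)) by rewrite /= oppr_lt0.
pose w : n := neg_elt hm.
exists (uea_in w * P); last by rewrite ractM ract_in.
move=> E V e y he; rewrite !ractM hP // !ract_in.
by rewrite [LHS]tensor_act_tens he (lin0 (tens_linearl _)) add0r.
Qed.

(** W_0 and the central element commute with every W_k, so they act on the whole
W-subspace as they do on the highest weight vector. *)
Lemma verma_W_eigen y : y \in verma_W c h hW ->
  act (eW 0 : W22) y = hW *: y /\ act (eC : W22) y = c *: y.
Proof.
have [_ w0 c0] := verma_v_zero c h hW.
move: y; apply: span_ind => [|a x y [Wx Cx] [Wy Cy]|_ [ms _ ->]].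
- by rewrite !(lin0 (act_linearr _)) !scaler0.
- rewrite !act_linearr Wx Wy Cx Cy (scalerDr hW) (scalerDr c) !scalerA.
  by rewrite (mulrC hW) (mulrC c).
have step (x : W22) (b : K) ms' : act x v = b *: v ->
    (forall k, lie x (eW k) = 0) ->
    act x (verma_Wmon c h hW ms') = b *: verma_Wmon c h hW ms'.
  move=> xv xW; elim: ms' => //= m ms' IH.
  rewrite -[LHS](subrK (act (eW (- m%:Z)) (act x (verma_Wmon c h hW ms')))).
  by rewrite -act_lie xW (lin0 (act_linearl _)) add0r IH linearZ.
split; apply: step => // k; first by rewrite [LHS]W22_lieUU.
exact: W22_lie_C.
Qed.

End WPolynomials.

Section SingularSubmodule.
Context {K : fieldType} {c h hW : K} (J : submodule (verma c h hW)).
Local Notation W22 := (W22 K).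
Local Notation n := (lsub (@Lminus K)).
Local Notation v := (verma_v c h hW).

(** The non-negative part acts on [u] by scalars: the positive part by zero, L_0
because [u] is an eigenvector, W_0 and C because [u] is in the W-subspace.
Hence U(n) u is already a submodule. *)
Lemma singular_submodule (u : verma c h hW) :
  singular u -> u \in verma_W c h hW -> J =i submodule_gen (fun x => x = u) ->
  forall q, q \in J -> exists y : uea n, q = ract y u.
Proof.
move=> [_ [lam L0u] Lpu] uW JE q; rewrite JE => qJ.
have [W0u Cu] := verma_W_eigen uW.
have posE i : ~~ negative i -> exists b, act (W22_e K i) u = b *: u.
  case: i => [m|m|] /=; last by exists c.
    rewrite -leNgt le_eqVlt => /orP[/eqP<-|m0]; first by exists lam.
    by exists 0; rewrite scale0r Lpu //; apply: mem_span; exists m => //; left.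
  rewrite -leNgt le_eqVlt => /orP[/eqP<-|m0]; first by exists hW.
  by exists 0; rewrite scale0r Lpu //; apply: mem_span; exists m => //; right.
have uS : u \in ract_span (n := Lminus) (fun x => x = u).
  by apply: mem_span; exists 1, u; rewrite ract1.
have hG (z : W22) g : g = u -> act z g \in ract_span (n := Lminus) (fun x => x = u).
  move=> ->; elim/(@W22_ind K): z => [|a x y hx hy|i].
  - by rewrite (lin0 (act_linearl _)) rpred0.
  - by rewrite act_linearl; apply: rpredD hy; apply: rpredZ.
  have [hi|/posE[b ->]] := boolP (negative i); last by rewrite rpredZ.
  apply: mem_span; exists (uea_in (neg_elt hi)), u; split=> //.
  by rewrite ract_in.
have {qJ} : q \in ract_gen hG by move/asboolP: qJ => /(_ (ract_gen hG)); apply=> _ ->.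
move: q; apply: span_ind => [|a x y [X ->] [Y ->]|_ [x [_ [-> ->]]]].
- by exists 0; rewrite ract0.
- by exists (a *: X + Y); rewrite ract_linearl.
by exists x.
Qed.

Lemma ract_mpi (x : uea n) (q : verma c h hW) :
  ract x (mpi J q) = mpi J (ract x q).
Proof.
by rewrite (ract_hom (mpi_linear J) (mpi_act J)).
Qed.

(** If x v is in J, then x v = z u = z P v with P a polynomial in the W_k, and
x = z P by freeness.  On the tensor product P reaches only the second factor,
where it produces the image of [u], which is zero. *)
Lemma annihilator_lift (u : verma c h hW) :
  singular u -> u \in verma_W c h hW -> J =i submodule_gen (fun x => x = u) ->
  forall (E : lieModType W22) (e : E), (forall m, act (eW m : W22) e = 0) ->
  forall x : uea n, ract x (mpi J v) = 0 -> ract x (tens e (mpi J v)) = 0.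
Proof.
move=> us uW JE E e he x; rewrite ract_mpi => /eqP; rewrite mpi_eq0 => xJ.
have [y xy] := singular_submodule us uW JE xJ.
have [P hP uP] := verma_W_lift uW.
have -> : x = y * P.
  apply/eqP; rewrite -subr_eq0; apply/eqP; apply: (@verma_free K c h hW).
  by rewrite (linB (ract_linearl _)) ractM -uP xy subrr.
have uJ : u \in J by rewrite JE; apply/asboolP => N; apply.
have u0 : mpi J u = 0 by apply/eqP; rewrite mpi_eq0.
by rewrite ractM hP // ract_mpi -uP u0 (lin0 (tens_linearr _)) (lin0 (ract_linearr _)).
Qed.

End SingularSubmodule.

(** * Tensor products with a ladder *)

Section Contraction.
Context {K : fieldType} {L : lieAlgType K} (E V : lieModType L).
Variables (xi : E -> K) (xi_lin : linear (xi : E -> K^o)).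

(** Applying a linear form to the first factor extracts components of a tensor. *)
Definition contract : tensor E V -> V :=
  descend (lext (fun p : E * V => xi p.1 *: p.2)).

Lemma contract_rel p : p \in span (@tensor_rel K L E V) ->
  lext (fun p : E * V => xi p.1 *: p.2) p = 0.
Proof.
pose f p := lext (fun p : E * V => xi p.1 *: p.2) p.
have f3 a A B C : f (A - (a *: B + C)) = f A - (a *: f B + f C).
  by rewrite /f linearB linearP.
have fU e w : f << (e, w) >> = xi e *: w by rewrite /f lextU.
move: p; apply: span_ind => [|a p q hp hq|_ [a e e' w|a e w w']].
- exact: linear0.
- by rewrite lext_linear hp hq scaler0 addr0.
- rewrite -/(f _) f3 !fU; have -> : xi (a *: e + e') = a * xi e + xi e' := xi_lin a e e'.
  by rewrite scalerDl scalerA subrr.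
by rewrite -/(f _) f3 !fU scalerDr !scalerA mulrC subrr.
Qed.

Lemma contract_linear : linear contract.
Proof. by apply: descend_linear contract_rel; apply: lext_linear. Qed.

Lemma contract_tens e w : contract (tens e w) = xi e *: w.
Proof.
rewrite /contract /tens descendE; [exact: lextU|exact: lext_linear|].
exact: contract_rel.
Qed.

End Contraction.

(** What the proof uses of an intermediate series module.  The vectors need not
span, and some may vanish: this covers the quotient by a line and the submodule
that omits a basis vector. *)
Record ladder (K : fieldType) (E : lieModType (W22 K)) := Ladder {
  lvec : int -> E;
  lcoef : int -> int -> K;
  ldual : int -> E -> K;
  lvec_L : forall k m, act (eL k : W22 K) (lvec m) = lcoef k m *: lvec (m + k);
  lvec_W : forall k m, act (eW k : W22 K) (lvec m) = 0;
  lvec_C : forall m, act (eC : W22 K) (lvec m) = 0;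
  ldual_linear : forall j, linear (ldual j : E -> K^o);
  ldual_off : forall i j, i != j -> ldual i (lvec j) = 0;
  ldual_diag : forall j, lvec j = 0 \/ ldual j (lvec j) = 1;
  ladder_step : exists k, lvec k != 0 /\ lvec (k - 1) != 0
}.

Section TensorReducible.
Context {K : fieldType} (E V : lieModType (W22 K)) (d : ladder E).
Local Notation W22 := (W22 K).
Local Notation n := (lsub (@Lminus K)).
Local Notation e := (lvec d).
Local Notation xi := (ldual d).
Let xi_lin := @ldual_linear K E d.
Let xi_off := @ldual_off K E d.

Variables (b : W22_basis -> K) (y : V).
Hypotheses (y_eigen : forall i, ~~ negative i -> act (W22_e K i) y = b i *: y)
  (y_ann : forall m (x : uea n), ract x y = 0 -> ract x (tens (e m) y) = 0).

(** Tensors supported on indices smaller than [m]: the error terms when U(n) acts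
on e_m ⊗ z. *)
Definition below (m : int) : subspace (tensor E V) :=
  span (fun t => exists j z, j < m /\ t = tens (e j) z).

Lemma below_le m m' t : m <= m' -> t \in below m -> t \in below m'.
Proof.
move=> mm'; apply: span_sub => _ [j [z [jm ->]]]; apply: mem_span.
by exists j, z; split=> //; apply: lt_le_trans mm'.
Qed.

Lemma act_below (x : n) m (z : V) : tens (act (val x) (e m)) z \in below m.
Proof.
move: (val x) (valP x); apply: span_ind => [|c u v hu hv|_ [[k|k|] hk ->]] //.
- by rewrite (lin0 (act_linearl _)) (lin0 (tens_linearl _)) rpred0.
- by rewrite act_linearl tens_linearl; apply: rpredD hv; apply: rpredZ.
- rewrite lvec_L (linZ (tens_linearl _)); apply: rpredZ; apply: mem_span.
  by exists (m + k), z; rewrite -ltrBrDl subrr.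
by rewrite lvec_W (lin0 (tens_linearl _)) rpred0.
Qed.

Lemma act_minus_below (x : n) m t : t \in below m -> act (val x) t \in below m.
Proof.
move: t; apply: span_ind => [|c u v hu hv|_ [j [z [jm ->]]]].
- by rewrite (lin0 (act_linearr _)) rpred0.
- by rewrite act_linearr; apply: rpredD hv; apply: rpredZ.
rewrite [act _ _]tensor_act_tens; apply: rpredD.
  by apply: below_le (act_below _ _ _); apply: ltW.
by apply: mem_span; exists j, (act (val x) z).
Qed.

Lemma ract_tens_leading (x : uea n) m (z : V) :
  ract x (tens (e m) z) - tens (e m) (ract x z) \in below m.
Proof.
elim/(@uea_ind K): x => [|c x x' hx hx'||u x hx].
- by rewrite !ract0 (lin0 (tens_linearr _)) subrr rpred0.
- rewrite !ract_linearl tens_linearr opprD addrACA -scalerBr.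
  by apply: rpredD hx'; apply: rpredZ.
- by rewrite !ract1 subrr rpred0.
rewrite !ractM !ract_in.
rewrite -(subrK (act (val u) (tens (e m) (ract x z))) (act _ (ract _ _))) -addrA.
rewrite -(linB (act_linearr _)); apply: rpredD; first exact: act_minus_below.
by rewrite [act _ (tens _ _)]tensor_act_tens addrK act_below.
Qed.

Lemma contract_below j m t : m <= j -> t \in below m -> contract (xi j) t = 0.
Proof.
move=> mj; have clin := contract_linear (V := V) (xi_lin j).
move: t; apply: span_ind => [|c u v hu hv|_ [i [z [im ->]]]].
- exact: lin0 clin.
- by rewrite clin hu hv scaler0 addr0.
by rewrite contract_tens ?xi_off ?scale0r // gt_eqF // (lt_le_trans im).
Qed.

Lemma contract_ract j m (x : uea n) (z : V) : m <= j ->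
  contract (xi j) (ract x (tens (e m) z)) = xi j (e m) *: ract x z.
Proof.
move=> mj; rewrite -(contract_tens (xi_lin j)); apply/eqP; rewrite -subr_eq0.
rewrite -(linB (contract_linear (V := V) (xi_lin j))).
by rewrite (contract_below mj) // ract_tens_leading.
Qed.

(** The component of largest index of the sum comes from its last term only, and is
x_r y; once it vanishes, [y_ann] removes that term and the sum gets shorter. *)
Lemma zero_of_contract k r (x : nat -> uea n) :
  (forall j, k <= j ->
    contract (xi j) (\sum_(i < r) ract (x i) (tens (e (k + i%:Z)) y)) = 0) ->
  \sum_(i < r) ract (x i) (tens (e (k + i%:Z)) y) = 0.
Proof.
elim: r => [|r IHr]; first by rewrite big_ord0.
rewrite big_ord_recr /=; set s := \sum_(i < r) _; move=> h.
suff top : ract (x r) (tens (e (k + r%:Z)) y) = 0.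
  by rewrite top addr0 in h *; apply: IHr.
have clin := contract_linear (V := V) (xi_lin (k + r%:Z)).
have s0 : contract (xi (k + r%:Z)) s = 0.
  apply: (big_rec (fun t => contract (xi (k + r%:Z)) t = 0)) => [|i t _ ht]; first exact: lin0 clin.
  rewrite (linD clin) ht contract_ract; last by rewrite lerD2l lez_nat ltnW.
  rewrite xi_off ?scale0r ?addr0 //.
  by rewrite (inj_eq (addrI k)) eqz_nat gtn_eqF.
have := h (k + r%:Z); rewrite lerDl => /(_ isT).
rewrite (linD clin) s0 add0r contract_ract // => xr.
have [e0|xi1] := ldual_diag d (k + r%:Z).
  by rewrite e0 (lin0 (tens_linearl _)) (lin0 (ract_linearr _)).
by apply: y_ann; move: xr; rewrite xi1 scale1r.
Qed.

Definition upper (k : int) (t : tensor E V) : Prop :=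
  exists2 m, k <= m & t = tens (e m) y.

(** The negative part is absorbed by U(n), and the rest acts on [y] by scalars and
does not decrease the index of e_m. *)
Lemma upper_act k z t : upper k t -> act z t \in ract_span (n := Lminus) (upper k).
Proof.
move=> [m km ->].
have gen m' : k <= m' -> tens (e m') y \in ract_span (n := Lminus) (upper k).
  move=> km'; apply: mem_span; exists 1, (tens (e m') y).
  by rewrite ract1; split=> //; exists m'.
elim/(@W22_ind K): z => [|c u v hu hv|i].
- by rewrite (lin0 (act_linearl _)) rpred0.
- by rewrite act_linearl; apply: rpredD hv; apply: rpredZ.
have [hi|hi] := boolP (negative i).
  apply: mem_span; exists (uea_in (neg_elt hi)), (tens (e m) y).
  by rewrite ract_in; split=> //; exists m.
rewrite [act _ _]tensor_act_tens y_eigen // (linZ (tens_linearr _)).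
apply: rpredD; last by apply: rpredZ; apply: gen.
case: i hi => [l|l|] hi.
- rewrite lvec_L (linZ (tens_linearl _)); apply: rpredZ; apply: gen.
  by rewrite (le_trans km) // lerDl leNgt.
- by rewrite lvec_W (lin0 (tens_linearl _)) rpred0.
by rewrite lvec_C (lin0 (tens_linearl _)) rpred0.
Qed.

(** Every sufficiently large length is allowed, so that two such expressions have a
common length and can be added term by term. *)
Lemma upper_sum k t : t \in ract_span (n := Lminus) (upper k) ->
  exists r (x : nat -> uea n), forall r', (r <= r')%N ->
    t = \sum_(i < r') ract (x i) (tens (e (k + i%:Z)) y).
Proof.
move: t; apply: span_ind => [|c t t' [r [x h]] [r' [x' h']]|_ [x [_ [[m km ->] ->]]]].
- exists 0%N, (fun=> 0) => r' _; symmetry; apply: big1 => i _.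
  exact: ract0.
- exists (maxn r r'), (fun i => c *: x i + x' i) => r''.
  rewrite geq_max => /andP[/h -> /h' ->].
  rewrite scaler_sumr -big_split /=; apply: eq_bigr => i _.
  by rewrite ract_linearl.
have [l ml] : exists l : nat, m = k + l%:Z.
  by exists `|m - k|%N; rewrite gez0_abs ?subr_ge0 // [RHS]addrC subrK.
exists l.+1, (fun i => if i == l then x else 0) => r' lr.
rewrite (bigD1 (Ordinal lr)) //= eqxx -ml big1 ?addr0 // => i.
by rewrite -val_eqE /= => /negPf ->; apply: ract0.
Qed.

(** The submodule generated by the e_m ⊗ y with m >= k does not contain
e_(k-1) ⊗ y: all components of the latter with index at least k vanish, so
[zero_of_contract] would make it zero. *)
Lemma tensor_reducible : y != 0 -> reducible (tensor E V).
Proof.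
move=> y0; have [k [ek0 ek1]] := ladder_step d.
have xi1 j : e j != 0 -> xi j (e j) = 1 by case: (ldual_diag d j) => // ->; rewrite eqxx.
have tens0 j : e j != 0 -> tens (e j) y != 0.
  move=> /xi1 h; apply: contra y0 => /eqP ty0.
  have := contract_tens (xi_lin j) (e j) y.
  by rewrite ty0 (lin0 (contract_linear (V := V) (xi_lin j))) h scale1r => <-.
exists (ract_gen (@upper_act k)); split.
  exists (tens (e k) y); last exact: tens0.
  apply: mem_span; exists 1, (tens (e k) y); rewrite ract1; split=> //.
  by exists k.
exists (tens (e (k - 1)) y); apply/negP => /upper_sum[r [x /(_ r (leqnn r)) tE]].
have := tens0 _ ek1; rewrite tE zero_of_contract ?eqxx // => j kj.
rewrite -tE contract_tens // xi_off ?scale0r //.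
by rewrite gt_eqF // (lt_le_trans _ kj) // gtrBl.
Qed.

End TensorReducible.

(** * The intermediate series are ladders *)

Section IntermediateSeries.
Context {K : numFieldType} (al be : K).

Lemma intser_actL k m : act (eL k : W22 K) (intser_v al be m) =
  intser_coef al be k m *: intser_v al be (m + k).
Proof. exact: intser_actUU. Qed.

Lemma intser_actW k m : act (eW k : W22 K) (intser_v al be m) = 0.
Proof. exact: intser_actUU. Qed.

Lemma intser_actC m : act (eC : W22 K) (intser_v al be m) = 0.
Proof. exact: intser_actUU. Qed.

Definition intser_dual (j : int) (x : intser al be) : K := mcoeff j x.

Lemma intser_dual_linear j : linear (intser_dual j : intser al be -> K^o).
Proof. by move=> a x y; rewrite /intser_dual mcoeffD mcoeffZ. Qed.

Lemma intser_dualE i j : intser_dual i (intser_v al be j) = (i == j)%:R.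
Proof. by rewrite /intser_dual /intser_v mcoeffU eq_sym. Qed.

Lemma intser_v_neq0 j : intser_v al be j != 0.
Proof.
apply/eqP => j0; have /eqP := intser_dualE j j.
by rewrite j0 eqxx (lin0 (intser_dual_linear j)) eq_sym oner_eq0.
Qed.

Definition intser_ladder : ladder (intser al be).
Proof.
apply: (Ladder intser_actL intser_actW intser_actC intser_dual_linear).
- by move=> i j /negPf ij; rewrite intser_dualE ij.
- by move=> j; right; rewrite intser_dualE eqxx.
- by exists 0; rewrite !intser_v_neq0.
Defined.

End IntermediateSeries.

Section IntegralIntermediateSeries.
Context {K : numFieldType} (al be : K) (k : int).
Hypothesis al_k : al = k%:~R.

(** The vanishing vector is e_(-k), and its dual form is set to zero. *)
Lemma line_ladder : be = 0 -> ladder (mquot (intser_line al be)).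
Proof.
move=> be0; pose e m := mpi (intser_line al be) (intser_v al be m).
have e0 : e (- k) = 0.
  apply/eqP; rewrite mpi_eq0; apply: mem_span; split=> //; exists (- k) => //.
  by rewrite al_k rmorphN.
pose xi j : mquot (intser_line al be) -> K :=
  if j == - k then fun=> 0 else @descend K (intser al be) K^o (intser_line al be)
    (intser_dual j).
have ker j x : j != - k -> x \in intser_line al be -> intser_dual j x = 0.
  move=> jk; move: x; apply: span_ind => [|a x y hx hy|_ [_ [m mE ->]]].
  - exact: lin0 (intser_dual_linear j).
  - by rewrite intser_dual_linear hx hy scaler0 addr0.
  rewrite intser_dualE; case: eqP => // jm; case/eqP: jk; rewrite jm.
  by apply: (@intr_inj K); rewrite mE al_k rmorphN.
have xi_mpi j x : j != - k -> xi j (mpi (intser_line al be) x) = intser_dual j x.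
  move=> jk; rewrite /xi (negPf jk).
  exact: (@descendE K (intser al be) K^o _ (intser_dual j)
    (intser_dual_linear j) (fun u => @ker j u jk)).
have xiE i j : i != - k -> xi i (e j) = (i == j)%:R.
  by move=> ik; rewrite xi_mpi // intser_dualE.
apply: (@Ladder K _ e (intser_coef al be) xi).
- by move=> l m; rewrite -mpi_act intser_actL (linZ (mpi_linear _)).
- by move=> l m; rewrite -mpi_act intser_actW (lin0 (mpi_linear _)).
- by move=> m; rewrite -mpi_act intser_actC (lin0 (mpi_linear _)).
- move=> j; rewrite /xi; case: eqP => [_|/eqP jk].
    by move=> a x y; rewrite scaler0 addr0.
  exact: (@descend_linear K (intser al be) K^o _ (intser_dual j)
    (intser_dual_linear j) (fun u => @ker j u jk)).
- move=> i j ij; have [->|ik] := eqVneq i (- k); first by rewrite /xi eqxx.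
  by rewrite xiE // (negPf ij).
- move=> j; have [->|jk] := eqVneq j (- k); first by left.
  by right; rewrite xiE // eqxx.
have neq0 j : j != - k -> e j != 0.
  move=> jk; apply/eqP => ej; have := xiE j j jk; rewrite ej eqxx.
  rewrite -(lin0 (mpi_linear (intser_line al be))) xi_mpi //.
  by rewrite (lin0 (intser_dual_linear j)) => /eqP; rewrite eq_sym oner_eq0.
(* The zero vector has index - k, so - k + 1 and - k + 2 are safe. *)
exists (- k + 2); split; apply: neq0.
  by rewrite gt_eqF // ltrDl.
by rewrite gt_eqF // -addrA ltrDl.
Qed.

(** The coefficient of L_l v_m vanishes when m + l is the omitted index -k-1; that
of L_l v_(-k-1) has to be replaced by zero, since e_(-k-1) is zero here. *)
Lemma omit_ladder : be = 1 -> ladder (msub (intser_omit al be)).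
Proof.
move=> be1; pose m0 := - k - 1.
have m0E : m0%:~R = - al - 1 :> K by rewrite al_k rmorphB rmorphN.
have mem m : m != m0 -> intser_v al be m \in intser_omit al be.
  move=> mm0; apply: mem_span; exists m => // -[_].
  by rewrite -m0E => /intr_inj/eqP; rewrite (negPf mm0).
pose e m : msub (intser_omit al be) :=
  if m == m0 then 0 else insubd 0 (intser_v al be m).
have eE m : val (e m) = if m == m0 then 0 else intser_v al be m.
  by rewrite /e; case: eqP => // /eqP mm0; rewrite insubdK // mem.
pose xi j (x : msub (intser_omit al be)) := intser_dual j (val x).
pose a l m := if m == m0 then 0 else intser_coef al be l m.
have dual0 j : intser_dual j (0 : intser al be) = 0 := lin0 (intser_dual_linear j).
have neq0 j : j != m0 -> xi j (e j) = 1.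
  by move=> jm0; rewrite /xi eE (negPf jm0) intser_dualE eqxx.
apply: (@Ladder K _ e a xi).
- move=> l m; apply: val_inj; rewrite [RHS]linearZ /= !eE /a.
  case: eqP => [_|mm0]; first by rewrite scale0r (lin0 (act_linearr _)).
  rewrite intser_actL; case: eqP => // mlm0.
  have mlE : m%:~R + l%:~R = - al - 1 :> K by rewrite -m0E -mlm0 rmorphD.
  suff -> : intser_coef al be l m = 0 by rewrite scale0r scaler0.
  rewrite /intser_coef be1 mulr1 addrAC (addrAC _ al) mlE (addrAC (- al)) addNr.
  by rewrite add0r addNr oppr0.
- move=> l m; apply: val_inj; rewrite [RHS]linear0 /= eE.
  by case: eqP => _; rewrite ?intser_actW ?(lin0 (act_linearr _)).
- move=> m; apply: val_inj; rewrite [RHS]linear0 /= eE.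
  by case: eqP => _; rewrite ?intser_actC ?(lin0 (act_linearr _)).
- by move=> j b x y; rewrite /xi linearP intser_dual_linear.
- move=> i j ij; rewrite /xi eE; case: eqP => _ //.
  by rewrite intser_dualE (negPf ij).
- move=> j; have [jm0|jm0] := eqVneq j m0; last by right; apply: neq0.
  by left; rewrite /e jm0 eqxx.
have e_neq0 j : j != m0 -> e j != 0.
  move=> /neq0 xi1; apply/eqP => ej; move: xi1; rewrite /xi ej linear0 dual0.
  by move/eqP; rewrite eq_sym oner_eq0.
(* The zero vector has index m0, so m0 + 1 and m0 + 2 are safe. *)
exists (m0 + 2); split; apply: e_neq0.
  by rewrite gt_eqF // ltrDl.
by rewrite gt_eqF // -addrA ltrDl.
Qed.

End IntegralIntermediateSeries.

(** * Reducibility *)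

Lemma intser'_ladder (K : numFieldType) (al be : K) :
  inhabited (ladder (intser' al be)).
Proof.
rewrite /intser'; case: asboolP => [[k alk]|_] /=; last exact/inhabits/intser_ladder.
case: eqP => [be0|_]; first exact/inhabits/(line_ladder alk be0).
case: eqP => [be1|_]; first exact/inhabits/(omit_ladder alk be1).
exact/inhabits/intser_ladder.
Qed.

Lemma ladder_tensor_reducible (K : fieldType) (c h hW : K)
    (J : submodule (verma c h hW)) (u : verma c h hW) (E : lieModType (W22 K)) :
  ladder E -> maximal_submodule J -> singular u -> u \in verma_W c h hW ->
  J =i submodule_gen (fun x => x = u) -> reducible (tensor E (mquot J)).
Proof.
move=> d [[q qJ] _] us uW JE.
have vJ : verma_v c h hW \notin J by apply: contra qJ => vJ; apply: verma_sub.
apply: (@tensor_reducible K E (mquot J) d (fun i => weight_char c h hW (W22_e K i))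
  (mpi J (verma_v c h hW))).
- by move=> i hi; rewrite -(mpi_act J) (verma_v_eigen _ _ _ hi) (linZ (mpi_linear J)).
- by move=> m x; apply: (annihilator_lift us uW JE) => l; apply: lvec_W.
- by rewrite mpi_eq0.
Qed.

Theorem theorem32 (R : realType) (c h hW alpha beta : R[i])
    (J : submodule (verma c h hW)) (u' : verma c h hW) :
  maximal_submodule J ->
  singular u' -> u' \in verma_W c h hW ->
  J =i submodule_gen (fun x => x = u') ->
  reducible (tensor (intser' alpha beta) (mquot J)).
Proof.
have [d] := intser'_ladder alpha beta.
exact: ladder_tensor_reducible.
Qed.
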